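(* Let $X$ be an $n\times n$ real symmetric random matrix with $X_{ij}=b_{ij}\xi_{ij}$ for $i\ne j$ and $X_{ii}=\sqrt{2}\,b_{ii}\xi_{ii}$, where $b_{ij}=b_{ji}\ge 0$ are arbitrary nonnegative scalars, and $\xi_{ij}=\xi_{ji}$ are symmetrically distributed real random variables that are independent for $i\ge j$ and satisfy $\mathbf{E}[\xi_{ij}^{2p}]\le\mathbf{E}[g^{2p}]$ for all $i,j$ and all $p\in\mathbb{N}$, where $g\sim N(0,1)$. Let $$\sigma^2:=\max_{i\le n}\sum_{j\le n} b_{ij}^2,\qquad \sigma_*^2:=\max_{i,j\le n} b_{ij}^2.$$ Then $$\mathbf{P}\big[\|X\|>2\sigma+\sigma_*(1+t)\big]\le 2n\,e^{-t^2/4}$$ for every $t\ge 0$.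
   Context: $\|X\|$ is the spectral norm (largest singular value). $\sigma,\sigma_*$ denote the nonnegative square roots. ''Symmetrically distributed'' means that $\xi_{ij}$ and $-\xi_{ij}$ have the same law. *)

(* Defs.v *)
From HB Require Import structures.
From mathcomp Require Export all_boot all_order all_algebra.
From mathcomp Require Export all_classical all_reals all_analysis.

Set Implicit Arguments.
Unset Strict Implicit.
Unset Printing Implicit Defensive.

Export Order.TTheory GRing.Theory Num.Theory.
Export numFieldNormedType.Exports.

#[global] Open Scope classical_set_scope.
#[global] Open Scope ring_scope.

(* The singular values of A are the nonnegative square roots of the
   eigenvalues of A^T A. *)
Definition singular_value {R : realType} {m n : nat} (A : 'M[R]_(m, n)) :
    set R :=
  [set s | 0 <= s /\ eigenvalue (A^T *m A) (s ^+ 2)].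

(* There are finitely many singular values, and at least one as soon as n > 0,
   so this supremum is a maximum; it is 0 when n = 0. *)
Definition spectral_norm {R : realType} {m n : nat} (A : 'M[R]_(m, n)) : R :=
  sup (singular_value A).

Definition independent_RVs {d : measure_display} {T : measurableType d}
    {R : realType} (P : probability T R) {I : finType} (D : {set I})
    (X : I -> {RV P >-> R}) : Prop :=
  forall (J : {set I}) (A : I -> set R), J \subset D ->
    (forall i, i \in J -> measurable (A i)) ->
    P (\bigcap_(i in [set` J]) (X i @^-1` A i))
    = (\prod_(i in J) P (X i @^-1` A i))%E.

Definition symmetrically_distributed {d : measure_display}
    {T : measurableType d} {R : realType} (P : probability T R)
    (X : {RV P >-> R}) : Prop :=
  forall A : set R, measurable A ->
    P (X @^-1` A) = P ((\- X) @^-1` A).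

Arguments independent_RVs {d T R} P {I} D X.
Arguments symmetrically_distributed {d T R} P X.

Definition random_mx {T : Type} {R : realType} {n : nat} (b : 'M[R]_n)
    (xi : 'I_n -> 'I_n -> T -> R) (w : T) : 'M[R]_n :=
  \matrix_(i, j) (if i == j then Num.sqrt 2 * b i i * xi i i w
                  else b i j * xi i j w).

(* All the terms are nonnegative, so the default value 0 of the maxima below
   only matters when n = 0. *)
Definition sigma {R : realType} {n : nat} (b : 'M[R]_n) : R :=
  Num.sqrt (\big[Num.max/0]_(i < n) \sum_(j < n) b i j ^+ 2).

Definition sigma_star {R : realType} {n : nat} (b : 'M[R]_n) : R :=
  Num.sqrt (\big[Num.max/0]_(i < n) \big[Num.max/0]_(j < n) b i j ^+ 2).

(* Main.v *)
(* The expected traces of the powers of X are compared with those of the Gaussian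
   orthogonal ensemble of dimension r, where r - 1 is the integer part of
   (sigma / sigma_star)^2. Expanding the trace of X^k over closed walks, the
   moment assumption allows Gaussian entries, and Wick's formula turns each walk
   into graphs with paired edges. A spanning tree of such a graph with m vertices
   contributes at most n (r sigma_star^2)^(m - 1), and each other edge at most
   sigma_star^2: up to the factor n / r, this is the contribution of the graph to
   the moment of sigma_star Y, with Y of dimension r.

   The moments of Y are bounded through the loop equations for products of traces
   of powers of Y + 2 q, with q^2 = r - 1. Without the terms that merge or
   reverse loops they are solved by q^2 times a semicircle law on [0, 4 q]. Adding
   a unit mass at the edge 4 q, and translating by a Gaussian variable of variance
   2, gives a super-solution of the full equations, whence
     E[tr (exp (x Y))] <= r exp (2 q x + x^2).
   The theorem follows from Markov's inequality for tr (cosh (s X)) with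
   s = t / (2 sigma_star), the series being truncated because only polynomial
   moments of X are known to be finite. *)
From HB Require Import structures.
Require Import Defs.
From mathcomp Require Import measurable_realfun ftc ring lra zify.

Set Implicit Arguments.
Unset Strict Implicit.
Unset Printing Implicit Defensive.
Import HBNNSimple.

(** * Moments of the shifted semicircle law *)

(** The bound is carried through products of traces, so every inequality must survive
    multiplication. Hence the shift by [2 * q]: it moves the semicircle law to [0, 4 q], where
    moments are nonnegative, and comparisons are made coefficientwise between polynomials in a
    translation variable, which is finally averaged over a Gaussian law. Integration by parts in
    this variable turns a product of traces into a sum over the other traces, the shape of the
    merging terms; the variance 2 is their coefficient. Merging further asks that the product of two
    moments dominate the moment of the sum of their orders, which the unit mass at the right end of
    the support ensures. The total mass [q ^+ 2 + 1] has to equal the dimension, which forces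
    [q ^+ 2 = r - 1]. This also absorbs the rounding of (sigma / sigma_star)^2: the tree bound needs
    [r] to be at least this ratio, whereas the exponent involves only the square root of [r - 1],
    and [r - 1] is at most the ratio. *)

Section Catalan.
Variable R : realFieldType.

Fixpoint catalan (k : nat) : R :=
  if k is j.+1 then (4 * j%:R + 2) / (j%:R + 2) * catalan j else 1.

Lemma catalanS k : (k%:R + 2) * catalan k.+1 = (4 * k%:R + 2) * catalan k.
Proof.
have nz : k%:R + 2 != 0 :> R by rewrite gt_eqF//; have := ler0n R k; lra.
by rewrite /= mulrA [_ / _]mulrC mulrA divff ?mul1r.
Qed.

Lemma catalan_ge0 k : 0 <= catalan k.
Proof.
elim: k => [|k IH] /=; first exact: ler01.
by apply: mulr_ge0 => //; apply: divr_ge0; have := ler0n R k; lra.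
Qed.

Lemma catalanS_le k : catalan k.+1 <= 4 * catalan k.
Proof.
have k0 := ler0n R k; have ck := catalan_ge0 k; have e := catalanS k.
rewrite -(@ler_pM2l _ (k%:R + 2)); last lra.
by rewrite e; nra.
Qed.

(** Reversing the summation exchanges the weights [i + 1] and [n - i + 1], whose sum is [n + 2]. *)
Lemma conv_sym (f : nat -> R) n :
  2 * \sum_(i < n.+1) i.+1%:R * (f i * f (n - i)%N)
  = (n%:R + 2) * \sum_(i < n.+1) f i * f (n - i)%N.
Proof.
rewrite mulr_sumr.
transitivity (\sum_(i < n.+1) (i.+1%:R * (f i * f (n - i)%N)
              + (n - i).+1%:R * (f i * f (n - i)%N))); last first.
  rewrite mulr_sumr; apply: eq_bigr => i _.
  rewrite -mulrDl -(natrD _ n 2) -(natrD _ i.+1); congr (_%:R * _).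
  by have := ltn_ord i; lia.
rewrite big_split/= [X in _ + X](reindex_inj rev_ord_inj)/=.
rewrite -big_split/=; apply: eq_bigr => i _.
have le_in : (i <= n)%N by have := ltn_ord i; lia.
rewrite !subSS subKn//; lra.
Qed.

(** [conv_sym] supplies the weight that [catalanS] needs on one factor; the convolution of order
    [n + 1] is thereby expressed by that of order [n], known by induction. *)
Lemma catalan_conv n :
  \sum_(i < n.+1) catalan i * catalan (n - i)%N = catalan n.+1.
Proof.
elim: n => [|n IH]; first by rewrite big_ord1 /= mulr1 mulr0 !add0r divff ?mulr1.
have h1 : 2 * (catalan n.+1 + \sum_(i < n.+1) (4 * i%:R + 2) *
    (catalan i * catalan (n - i)%N)) = (n.+1%:R + 2) *
    \sum_(i < n.+2) catalan i * catalan (n.+1 - i)%N.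
  rewrite -(conv_sym catalan) [in RHS]big_ord_recl [X in _ = _ * (X + _)]mul1r mul1r.
  rewrite subn0; congr (_ * (_ + _)).
  apply: eq_bigr => i _; rewrite mulrA -catalanS lift0 subSS [RHS]mulrA.
  by rewrite -(natrD _ i 2) addn2.
have e : \sum_(i < n.+1) (4 * i%:R + 2) * (catalan i * catalan (n - i)%N) =
  4 * \sum_(i < n.+1) i.+1%:R * (catalan i * catalan (n - i)%N)
  - 2 * \sum_(i < n.+1) (catalan i * catalan (n - i)%N).
  rewrite !mulr_sumr -sumrB; apply: eq_bigr => i _; rewrite -(natr1 i); lra.
have h2 := conv_sym catalan n; have h3 := catalanS n.+1.
move: h1 h2 h3; rewrite e IH -(natr1 n).
move: (\sum_(i < n.+1) _) (\sum_(i < n.+2) _) (catalan n.+1) (catalan n.+2).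
move=> S T a b h1 h2 h3; have n0 := ler0n R n.
have nz : n%:R + 3 != 0 :> R by apply/eqP; lra.
apply: (mulfI nz); lra.
Qed.
End Catalan.
Arguments catalan R k : simpl never.

Section SelSum.
Variables (T : Type).

(* Sum of [F x s'] over all ways of extracting one element [x] from [s], [s']
   being the remaining list. *)
Fixpoint selsum (M : nmodType) (s : seq T) (F : T -> seq T -> M) : M :=
  if s is x :: s' then F x s' + selsum s' (fun y t => F y (x :: t)) else 0.

Lemma eq_selsum (M : nmodType) s (F G : T -> seq T -> M) :
  (forall s1 x s2, s = s1 ++ x :: s2 -> F x (s1 ++ s2) = G x (s1 ++ s2)) ->
  selsum s F = selsum s G.
Proof.
elim: s F G => [|x s IH] F G FG //=; congr (_ + _); first exact: (FG [::]).
by apply: IH => s1 y s2 st; apply: (FG (x :: s1)); rewrite st.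
Qed.

Lemma selsum_cat (M : nmodType) s1 s2 (F : T -> seq T -> M) :
  selsum (s1 ++ s2) F =
  selsum s1 (fun x t => F x (t ++ s2)) + selsum s2 (fun x t => F x (s1 ++ t)).
Proof. by elim: s1 F => [|x s IH] F /=; rewrite ?add0r// IH addrA. Qed.

Lemma selsum_morph (M N : nmodType) (f : {additive M -> N}) s
    (F : T -> seq T -> M) : f (selsum s F) = selsum s (fun x t => f (F x t)).
Proof. by elim: s F => [|x s IH] F /=; rewrite ?raddf0// raddfD IH. Qed.

Lemma mulr_selsumr (M : pzSemiRingType) a s (F : T -> seq T -> M) :
  a * selsum s F = selsum s (fun x t => a * F x t).
Proof. by elim: s F => [|x s IH] F /=; rewrite ?mulr0// mulrDr IH. Qed.

Lemma selsum_sum (M : nmodType) (I : Type) (r : seq I) s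
    (F : I -> T -> seq T -> M) :
  selsum s (fun x t => \sum_(i <- r) F i x t) = \sum_(i <- r) selsum s (F i).
Proof.
elim: s F => [|x s IH] F /=; first by rewrite big1.
by rewrite IH big_split.
Qed.

Lemma ler_selsum (R : numDomainType) s (F G : T -> seq T -> R) :
  (forall s1 x s2, s = s1 ++ x :: s2 -> F x (s1 ++ s2) <= G x (s1 ++ s2)) ->
  selsum s F <= selsum s G.
Proof.
elim: s F G => [|x s IH] F G FG //=; apply: lerD; first exact: (FG [::]).
by apply: IH => s1 y s2 st; apply: (FG (x :: s1)); rewrite st.
Qed.

End SelSum.

(** * Appell sequences and coefficientwise positivity *)

Section Appell.
Variable R : realFieldType.
Implicit Types (p f g : nat -> {poly R}).

Definition nnpoly (p : {poly R}) := forall i, 0 <= p`_i.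

Lemma nnpoly0 : nnpoly 0.
Proof. by move=> i; rewrite coef0. Qed.

Lemma nnpolyC a : 0 <= a -> nnpoly a%:P.
Proof. by move=> a0 i; rewrite coefC; case: ifP. Qed.

Lemma nnpolyX : nnpoly 'X.
Proof. by move=> i; rewrite coefX ler0n. Qed.

Lemma nnpolyD (p1 p2 : {poly R}) : nnpoly p1 -> nnpoly p2 -> nnpoly (p1 + p2).
Proof. by move=> p1P p2P i; rewrite coefD addr_ge0. Qed.

Lemma nnpolyM (p1 p2 : {poly R}) : nnpoly p1 -> nnpoly p2 -> nnpoly (p1 * p2).
Proof.
by move=> p1P p2P i; rewrite coefM sumr_ge0// => j _; rewrite mulr_ge0.
Qed.

Lemma nnpolyMn (p1 : {poly R}) n : nnpoly p1 -> nnpoly (p1 *+ n).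
Proof. by move=> p1P i; rewrite coefMn mulrn_wge0. Qed.

Lemma nnpolyXn (p1 : {poly R}) n : nnpoly p1 -> nnpoly (p1 ^+ n).
Proof.
move=> p1P; elim: n => [|n IH]; first by rewrite expr0; apply: nnpolyC ler01.
by rewrite exprS; apply: nnpolyM.
Qed.

Definition conv f g k := \sum_(a < k) f a * g (k.-1 - a)%N.

(** Satisfied by the moments of a law, seen as polynomials in a translation parameter. *)
Definition appell p := forall k, (p k)^`() = p k.-1 *+ k.

Lemma appell_conv f g : appell f -> appell g -> appell (conv f g).
Proof.
move=> fA gA [|k]; rewrite /conv; first by rewrite !big_ord0 linear0.
rewrite raddf_sum /=.
under eq_bigr do rewrite derivM fA gA.
rewrite big_split/= big_ord_recl mulr0n mul0r add0r big_ord_recr/=.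
rewrite subnn mulr0n mulr0 addr0 -big_split/= -sumrMnl.
apply: eq_bigr => i _; rewrite /bump/= add1n.
have lt_ik := ltn_ord i.
have -> : (k - i.+1 = k.-1 - i)%N by lia.
have -> : ((k - i).-1 = k.-1 - i)%N by lia.
rewrite !(mulrnAl, mulrnAr) -mulrnDr; congr (_ *+ _); lia.
Qed.

(** The derivative links the coefficient [i + 1] of [p k] to the coefficient [i] of [p k.-1].
    Inequalities between polynomials thus reduce to inequalities between their values at 0. *)
Lemma appell_nneg p : appell p -> (forall k, 0 <= (p k).[0]) ->
  forall k, nnpoly (p k).
Proof.
move=> pA p0 k i.
elim: i k => [|i IH] k; first by rewrite -horner_coef0.
have := coef_deriv (p k) i; rewrite pA coefMn => e.
by rewrite -(pmulrn_lge0 _ (ltn0Sn i)) -e mulrn_wge0.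
Qed.

Lemma appell_eq0 p : appell p -> (forall k, (p k).[0] = 0) ->
  forall k, p k = 0.
Proof.
move=> pA p0 k; apply/polyP => i; rewrite coef0.
elim: i k => [|i IH] k; first by rewrite -horner_coef0.
have := coef_deriv (p k) i; rewrite pA coefMn IH mul0rn => /esym/eqP.
by rewrite mulrn_eq0 => /eqP.
Qed.

End Appell.
Arguments conv {R} f g k.

Section ShiftedSemicircle.
Variables (R : realFieldType) (q : R).
Hypothesis q_ge0 : 0 <= q.
Local Notation c := (catalan R).

(* Moments of the semicircle law of variance [q ^+ 2] shifted to [0, 4 q]. *)
Definition smom k := q ^+ k * c k.+1.

Lemma smom_ge0 k : 0 <= smom k.
Proof. by apply: mulr_ge0; rewrite ?exprn_ge0 ?catalan_ge0. Qed.

(** The two end terms of the Catalan convolution give the drift [2 * q], the inner ones the products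
    of moments. *)
Lemma smom_rec k : smom k.+1 =
  2 * q * smom k + q ^+ 2 * \sum_(a < k) smom a * smom (k.-1 - a)%N.
Proof.
rewrite /smom -catalan_conv big_ord_recl subn0 big_ord_recr/= subnn.
rewrite (_ : c 0 = 1)// mul1r mulr1 !mulrDr addrA addrAC.
congr (_ + _); first by rewrite exprS; lra.
rewrite !mulr_sumr; apply: eq_bigr => i _; rewrite /bump/= add1n.
have lt_ik := ltn_ord i.
rewrite (_ : k.+1 - i.+1 = (k.-1 - i).+1)%N ?subSS; last lia.
rewrite (_ : k.+1 = (2 + (i + (k.-1 - i)))%N); last lia.
by rewrite !exprD; lra.
Qed.

Lemma smomS_le k : smom k.+1 <= 4 * q * smom k.
Proof.
rewrite /smom exprS (_ : 4 * q * _ = q * q ^+ k * (4 * c k.+1)); last by ring.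
by rewrite ler_wpM2l ?catalanS_le// mulr_ge0// exprn_ge0.
Qed.

(** The sum is the integral of ((4 q)^k - x^k) / (4 q - x) against the shifted semicircle law;
    dropping x^k leaves (4 q)^k times the value 1 / q of the Stieltjes transform at the edge 4 q. *)
Lemma smom_resolvent k :
  q * \sum_(a < k) (4 * q) ^+ a * smom (k.-1 - a)%N <= (4 * q) ^+ k.
Proof.
(* The defect is known exactly: [(2 * k%:R + 1) * c k] is the binomial coefficient of 2 k + 1 over
   k. *)
suff -> : q * \sum_(a < k) (4 * q) ^+ a * smom (k.-1 - a)%N =
    (4 * q) ^+ k - q ^+ k * ((2 * k%:R + 1) * c k).
  by rewrite gerBl mulr_ge0 ?exprn_ge0// mulr_ge0 ?catalan_ge0// addr_ge0 ?mulr_ge0.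
elim: k => [|k IH]; first by rewrite big_ord0 !expr0 (_ : c 0 = 1)//; ring.
rewrite big_ord_recl expr0 mul1r subn0 mulrDr.
have -> : q * \sum_(i < k) (4 * q) ^+ (lift ord0 i) * smom (k.+1.-1 - lift ord0 i)%N
    = 4 * q * (q * \sum_(a < k) (4 * q) ^+ a * smom (k.-1 - a)%N).
  rewrite mulrCA [in RHS]mulr_sumr; congr (_ * _); apply: eq_bigr => i _.
  by rewrite lift0 exprS -mulrA; congr (_ * (_ * smom _)); have := ltn_ord i; lia.
rewrite IH /smom -(natr1 k) !exprS.
have := catalanS R k; move: (c k) (c k.+1) (q ^+ k) ((4 * q) ^+ k) => a b x y e.
have -> : 4 * q * (y - x * ((2 * k%:R + 1) * a)) =
  4 * q * y - q * x * (2 * ((4 * k%:R + 2) * a)) by ring.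
rewrite -e; ring.
Qed.

(* [(smomp k).[x]] is the [k]-th moment of the shifted law translated by [x]. *)
Definition smomp k : {poly R} := \poly_(i < k.+1) ('C(k, i)%:R * smom (k - i)%N).

Lemma coef_smomp k i : (smomp k)`_i = 'C(k, i)%:R * smom (k - i)%N.
Proof. by rewrite coef_poly; case: ltnP => // ?; rewrite bin_small// mul0r. Qed.

Lemma smomp0E k : (smomp k).[0] = smom k.
Proof. by rewrite horner_coef0 coef_smomp bin0 mul1r subn0. Qed.

Lemma smomp_appell : appell smomp.
Proof.
move=> k; apply/polyP => i; rewrite coef_deriv coefMn !coef_smomp.
rewrite -!mulrnAl -!mulrnA; case: k => [|k] /=; first by rewrite !muln0.
rewrite subSS; congr (_%:R * _); rewrite mulnC [RHS]mulnC.
by have := mul_bin_diag k.+1 i; rewrite /= => ->.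
Qed.

Lemma smomp_0 : smomp 0 = 1.
Proof.
apply/polyP => i; rewrite coef_smomp coef1 /smom /= bin0n; case: i => [|i] /=.
  by rewrite expr0 !mul1r -catalan_conv big_ord1 mulr1.
by rewrite mul0r.
Qed.

Lemma smomp_nneg k : nnpoly (smomp k).
Proof.
by apply: appell_nneg => [|j]; [exact: smomp_appell|rewrite smomp0E smom_ge0].
Qed.

Local Notation eta := ('X + (2 * q)%:P : {poly R}).
Local Notation E := ('X + (4 * q)%:P : {poly R}).

Lemma appell_mulX (a : R) f : appell f ->
  appell (fun k => ('X + a%:P) * f k - f k.+1).
Proof.
move=> fA k; rewrite derivB derivM derivD derivX derivC addr0 mul1r !fA /=.
by case: k => [|k] /=; rewrite ?mulr0n ?mulr1n; ring.
Qed.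

Lemma smomp_rec k :
  smomp k.+1 = eta * smomp k + q ^+ 2 *: conv smomp smomp k.
Proof.
apply/eqP; rewrite -subr_eq0 -oppr_eq0 opprB addrAC; apply/eqP.
move: k; apply: appell_eq0 => k; last first.
  have e : (conv smomp smomp k).[0] = \sum_(a < k) smom a * smom (k.-1 - a)%N.
    by rewrite horner_sum; apply: eq_bigr => a _; rewrite hornerM !smomp0E.
  rewrite !(hornerD, hornerN, hornerM, hornerZ, hornerX, hornerC) e.
  by rewrite !smomp0E smom_rec; ring.
rewrite derivD derivZ (appell_mulX (2 * q) smomp_appell).
by rewrite (appell_conv smomp_appell smomp_appell) -scalerMnr -mulrnDl.
Qed.

Lemma powE_appell : appell (fun k => E ^+ k).
Proof. by move=> k; rewrite deriv_exp derivD derivX derivC addr0 mul1r. Qed.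

Lemma hornerE0 : E.[0] = 4 * q.
Proof. by rewrite hornerD hornerX hornerC add0r. Qed.

Lemma E_nneg : nnpoly (E).
Proof.
by apply: nnpolyD; [exact: nnpolyX|apply: nnpolyC; rewrite mulr_ge0].
Qed.

Lemma smompS_le k : nnpoly (E * smomp k - smomp k.+1).
Proof.
apply: (appell_nneg (p := fun k => E * smomp k - smomp k.+1)) => [|j].
  exact/appell_mulX/smomp_appell.
rewrite hornerD hornerN hornerM hornerE0 !smomp0E subr_ge0.
exact: smomS_le.
Qed.

(** Coefficientwise form of the fact that no point of the support exceeds the edge [E]. *)
Lemma smomp_le_mul a b : nnpoly (E ^+ a * smomp b - smomp (a + b)).
Proof.
elim: a b => [|a IH] b; first by rewrite mul1r subrr; exact: nnpoly0.
have -> : E ^+ a.+1 * smomp b - smomp (a.+1 + b) =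
  E ^+ a * (E * smomp b - smomp b.+1) + (E ^+ a * smomp b.+1 - smomp (a + b.+1)).
  by rewrite addSnnS exprSr; ring.
by apply: nnpolyD => //; apply: nnpolyM; [exact: nnpolyXn E_nneg|exact: smompS_le].
Qed.

Lemma smomp_resolvent k :
  nnpoly (E ^+ k - q *: conv (fun j => E ^+ j) smomp k).
Proof.
apply: (appell_nneg (p := fun k => E ^+ k - q *: conv (fun j => E ^+ j) smomp k)).
  move=> j; rewrite derivB derivZ powE_appell.
  by rewrite (appell_conv powE_appell smomp_appell) -scalerMnr mulrnBl.
move=> j; rewrite hornerD hornerN hornerZ horner_exp hornerE0 subr_ge0.
apply: le_trans (smom_resolvent j); rewrite le_eqVlt; apply/orP; left; apply/eqP.
congr (_ * _); rewrite horner_sum; apply: eq_bigr => a _.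
by rewrite hornerM horner_exp hornerE0 smomp0E.
Qed.

(* [(1 + q ^+ 2)] times the moment polynomials of the mixture of an atom at the
   right edge [4 q] of the shifted semicircle law, of weight [1 / (1 + q ^+ 2)],
   with that law. The atom pays for the terms of the loop equations that merge
   two traces. *)
Definition mixp k : {poly R} := E ^+ k + q ^+ 2 *: smomp k.

Lemma mixp_nneg k : nnpoly (mixp k).
Proof.
rewrite /mixp -mul_polyC; apply: nnpolyD; first exact: nnpolyXn E_nneg.
by apply: nnpolyM; [apply: nnpolyC; exact: exprn_ge0|exact: smomp_nneg].
Qed.

Lemma mixp_appell : appell mixp.
Proof.
by move=> k; rewrite derivD derivZ powE_appell smomp_appell -scalerMnr mulrnDl.
Qed.

Lemma mixp_0 : mixp 0 = (1 + q ^+ 2)%:P.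
Proof. by rewrite /mixp expr0 smomp_0 polyCD -mul_polyC mulr1. Qed.

(** The product of the two atoms is the atom of order [a + b]; the atom of order [a] times the law
    of order [b] is controlled by [smomp_le_mul], and what remains is nonnegative. *)
Lemma mixp_mul_le a b : nnpoly (mixp a * mixp b - mixp (a + b)).
Proof.
have q2 : nnpoly (q ^+ 2)%:P by apply: nnpolyC; exact: exprn_ge0.
have -> : mixp a * mixp b - mixp (a + b) =
  (q ^+ 2)%:P * (E ^+ a * smomp b - smomp (a + b)) +
  (q ^+ 2)%:P * smomp a * mixp b.
  by rewrite /mixp -!mul_polyC exprD; ring.
apply: nnpolyD; first by apply: nnpolyM => //; exact: smomp_le_mul.
by apply: nnpolyM; [apply: nnpolyM => //; exact: smomp_nneg|exact: mixp_nneg].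
Qed.

(** Compared with [smomp_rec], the atom brings in its self-convolution, exactly [E ^+ k.-1 *+ k],
    which [mixp k.-1 *+ k] absorbs, and twice its convolution with the law, which [smomp_resolvent]
    bounds by means of the surplus [2 * q] of [E] over [eta]. *)
Lemma mixp_rec_le k :
  nnpoly (mixp k.+1 + mixp k.-1 *+ k - (eta * mixp k + conv mixp mixp k)).
Proof.
have convE : conv mixp mixp k = E ^+ k.-1 *+ k
    + (q ^+ 2)%:P * (2 * conv (fun j => E ^+ j) smomp k)
    + (q ^+ 2)%:P ^+ 2 * conv smomp smomp k.
  have sw : \sum_(a < k) smomp a * E ^+ (k.-1 - a) = conv (fun j => E ^+ j) smomp k.
    rewrite /conv [RHS](reindex_inj rev_ord_inj)/=; apply: eq_bigr => i _.
    have lt_ik := ltn_ord i; rewrite mulrC; congr (E ^+ _ * smomp _); lia.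
  have pw : \sum_(a < k) E ^+ a * E ^+ (k.-1 - a) = E ^+ k.-1 *+ k.
    rewrite (eq_bigr (fun=> E ^+ k.-1)) ?sumr_const ?card_ord// => a _.
    by rewrite -exprD; congr (_ ^+ _); have := ltn_ord a; lia.
  have -> : 2 * conv (fun j => E ^+ j) smomp k =
      \sum_(a < k) smomp a * E ^+ (k.-1 - a) + conv (fun j => E ^+ j) smomp k.
    by rewrite sw mulr_natl mulr2n.
  rewrite -pw.
  rewrite /conv mulrDr !mulr_sumr -!big_split/=; apply: eq_bigr => a _.
  by rewrite /mixp -!mul_polyC; ring.
have -> : mixp k.+1 + mixp k.-1 *+ k - (eta * mixp k + conv mixp mixp k) =
  2 * q%:P * (E ^+ k - q *: conv (fun j => E ^+ j) smomp k)
  + (q ^+ 2)%:P * smomp k.-1 *+ k.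
  rewrite convE /mixp smomp_rec -!mul_polyC exprS mulrnDl.
  have -> : (4 * q)%:P = (2 * q)%:P + 2 * q%:P :> {poly R}.
    by rewrite [2 * q%:P]mulr_natl -polyCMn -polyCD; congr _%:P; ring.
  by rewrite rmorphXn /=; ring.
apply: nnpolyD.
  apply: nnpolyM; last exact: smomp_resolvent.
  by rewrite mulr_natl; apply: nnpolyMn; apply: nnpolyC.
apply: nnpolyMn; apply: nnpolyM; last exact: smomp_nneg.
by apply: nnpolyC; exact: exprn_ge0.
Qed.

End ShiftedSemicircle.

(** * Super-solution of the loop equations *)

Section GaussianFunctional.
Variable R : realFieldType.

(* Moments of the centered Gaussian law of variance [v]. *)
Fixpoint gmom (v : R) (k : nat) : R :=
  match k with 0 => 1 | 1 => 0 | (j.+1 as i).+1 => v * i%:R * gmom v j end.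

Lemma gmomS v k : gmom v k.+1 = v * k%:R * gmom v k.-1.
Proof. by case: k => [|k] //=; rewrite mulr0 mul0r. Qed.

Arguments gmom v k : simpl never.

Lemma gmom_ge0 v k : 0 <= v -> 0 <= gmom v k.
Proof.
move=> v0; elim/ltn_ind: k => -[|[|k]] IH //.
by rewrite gmomS !mulr_ge0// IH.
Qed.

(** Expectation under the centered Gaussian law of variance 2; this variance reproduces the factor 2
    of the merging terms in [loop_supersolution]. *)
Definition gauss_eval (p : {poly R}) : R := \sum_(i < size p) p`_i * gmom 2 i.

Lemma gauss_evalE n (p : {poly R}) : (size p <= n)%N -> gauss_eval p = \sum_(i < n) p`_i * gmom 2 i.
Proof.
move=> le_pn; rewrite /gauss_eval (big_ord_widen n (fun i => p`_i * gmom 2 i))//.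
rewrite big_mkcond/=; apply: eq_bigr => i _.
by case: ltnP => // le_pi; rewrite nth_default// mul0r.
Qed.

Lemma gauss_eval_is_linear : linear_for *%R gauss_eval.
Proof.
move=> a p p'; set n := maxn (size p) (size p').
have sp : (size p <= n)%N by rewrite leq_maxl.
have sp' : (size p' <= n)%N by rewrite leq_maxr.
rewrite (gauss_evalE sp) (gauss_evalE sp') (@gauss_evalE n); last first.
  by apply: leq_trans (size_polyD _ _) _; rewrite geq_max sp' (leq_trans (size_scale_leq _ _)).
rewrite mulr_sumr -big_split/=; apply: eq_bigr => i _.
by rewrite coefD coefZ mulrDl mulrA.
Qed.

HB.instance Definition _ := GRing.isLinear.Build R {poly R} R *%R gauss_eval
  gauss_eval_is_linear.

Lemma gauss_eval_ge0 p : nnpoly p -> 0 <= gauss_eval p.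
Proof. by move=> p0; apply: sumr_ge0 => i _; rewrite mulr_ge0 ?gmom_ge0. Qed.

Lemma gauss_evalC a : gauss_eval a%:P = a.
Proof.
rewrite (@gauss_evalE 1) ?size_polyC; last by case: (a != 0).
by rewrite big_ord1 coefC mulr1.
Qed.

Lemma gauss_evalCM a p : gauss_eval (a%:P * p) = a * gauss_eval p.
Proof. by rewrite mul_polyC linearZ. Qed.

Lemma gauss_evalXn k : gauss_eval 'X^k = gmom 2 k.
Proof.
rewrite (@gauss_evalE k.+1) ?size_polyXn// big_ord_recr/= coefXn eqxx mul1r.
rewrite big1 ?add0r// => i _.
by rewrite coefXn ltn_eqF ?mul0r.
Qed.

(* Gaussian integration by parts. *)
Lemma gauss_evalXM p : gauss_eval ('X * p) = 2 * gauss_eval p^`().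
Proof.
have sd : (size p^`() <= size p)%N.
  by have [->|/lt_size_deriv/ltnW//] := eqVneq p 0; rewrite linear0.
rewrite (gauss_evalE sd) (@gauss_evalE (size p).+2); last first.
  by apply: leq_trans (size_polyMleq _ _) _; rewrite size_polyX.
rewrite big_ord_recl coefXM mul0r add0r big_ord_recl coefXM /= mulr0 add0r.
rewrite mulr_sumr; apply: eq_bigr => i _.
by rewrite /bump/= !add1n coefXM coef_deriv gmomS -mulr_natr /=; ring.
Qed.

End GaussianFunctional.
Arguments gmom {R} v k : simpl never.
Arguments gauss_eval {R} p.

Section LoopEquation.
Variables (R : realFieldType) (q : R).
Hypothesis q_ge0 : 0 <= q.
Local Notation Z := (mixp q).
Local Notation B ks := (gauss_eval (\prod_(k <- ks) Z k)).

Lemma nnpoly_prod_mixp ks : nnpoly (\prod_(k <- ks) Z k).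
Proof.
elim: ks => [|k ks IH]; first by rewrite big_nil; apply: nnpolyC ler01.
by rewrite big_cons; apply: nnpolyM => //; exact: mixp_nneg.
Qed.

Lemma deriv_prod_mixp ks : (\prod_(k <- ks) Z k)^`() =
  selsum ks (fun l t => (Z l.-1 *+ l) * \prod_(k <- t) Z k).
Proof.
elim: ks => [|k ks IH] /=; first by rewrite big_nil -polyC1 derivC.
rewrite big_cons derivM mixp_appell IH; congr (_ + _).
rewrite mulr_selsumr.
by apply: eq_selsum => s1 l s2 _; rewrite big_cons /= mulrCA.
Qed.

Lemma gauss_eval_le (p p' : {poly R}) : nnpoly (p' - p) -> gauss_eval p <= gauss_eval p'.
Proof. by move=> /gauss_eval_ge0; rewrite linearB subr_ge0. Qed.

(* [B] turns the loop equations of [loop_bound] into inequalities: Gaussian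
   integration by parts produces the last two sums. *)
Lemma loop_supersolution k ks :
  2 * q * B (k :: ks) + \sum_(a < k) B [:: nat_of_ord a, (k.-1 - a)%N & ks]
  + k%:R * B (k.-1 :: ks)
  + 2 * selsum ks (fun l t => l%:R * B ((k + l.-1)%N :: t)) <= B (k.+1 :: ks).
Proof.
set Pi := \prod_(l <- ks) Z l.
have le1 : gauss_eval ((('X + (2 * q)%:P) * Z k + conv Z Z k - Z k.-1 *+ k) * Pi)
    <= B (k.+1 :: ks).
  rewrite big_cons; apply: gauss_eval_le; rewrite -mulrBl; apply: nnpolyM.
    by have := mixp_rec_le q_ge0 k; congr nnpoly; ring.
  exact: nnpoly_prod_mixp.
apply: le_trans le1.
have -> : (('X + (2 * q)%:P) * Z k + conv Z Z k - Z k.-1 *+ k) * Pi =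
  'X * (Z k * Pi) + (2 * q)%:P * (Z k * Pi) + conv Z Z k * Pi - (Z k.-1 * Pi) *+ k.
  by ring.
(* Integration by parts yields [2 * k] copies of [Z k.-1 * Pi]; the subtracted term consumes [k] of
   them, and the other [k] are the term [k%:R * B (k.-1 :: ks)] of the goal. *)
rewrite linearB !linearD /= linearMn gauss_evalXM gauss_evalCM.
rewrite derivM mixp_appell [_ *+ k * Pi]mulrnAl linearD /= linearMn /=.
have -> : gauss_eval (conv Z Z k * Pi) =
    \sum_(a < k) B [:: nat_of_ord a, (k.-1 - a)%N & ks].
  by rewrite mulr_suml linear_sum; apply: eq_bigr => a _; rewrite !big_cons mulrA.
have le2 : selsum ks (fun l t => l%:R * B ((k + l.-1)%N :: t)) <=
    gauss_eval (Z k * Pi^`()).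
  rewrite deriv_prod_mixp mulr_selsumr selsum_morph.
  apply: ler_selsum => s1 l s2 _.
  rewrite big_cons /= [X in _ <= gauss_eval X](_ : _ =
    (Z k * (Z l.-1 * \prod_(j <- s1 ++ s2) Z j)) *+ l); last by ring.
  rewrite linearMn -[X in _ <= X]mulr_natl.
  apply: ler_wpM2l => //; apply: gauss_eval_le; rewrite mulrA -mulrBl.
  by apply: nnpolyM; [exact: mixp_mul_le|exact: nnpoly_prod_mixp].
rewrite !big_cons -/Pi -[_ *+ k]mulr_natl; move: le2; lra.
Qed.

(** All coefficients of the loop equations are nonnegative, so [loop_supersolution] propagates the
    bound along the recursion that determines [T]. *)
Lemma loop_bound (T : seq nat -> R) :
  T [::] = 1 -> (forall ks, T (0%N :: ks) = (1 + q ^+ 2) * T ks) ->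
  (forall k ks, T (k.+1 :: ks) =
    2 * q * T (k :: ks) + \sum_(a < k) T [:: nat_of_ord a, (k.-1 - a)%N & ks]
    + k%:R * T (k.-1 :: ks)
    + 2 * selsum ks (fun l t => l%:R * T ((k + l.-1)%N :: t))) ->
  forall ks, T ks <= B ks.
Proof.
move=> T_nil T_0 T_S ks.
(* Removing an empty loop lowers [size ks]; splitting a loop raises it by one but lowers the total
   length [sumn ks] by two. *)
move: {2}(2 * sumn ks + size ks)%N (leqnn (2 * sumn ks + size ks)%N) => N.
elim: N ks => [|N IH] [|k ks] le_N; try by move: le_N => /=; lia.
- by rewrite T_nil big_nil -polyC1 gauss_evalC.
- by rewrite T_nil big_nil -polyC1 gauss_evalC.
case: k => [|k] /= in le_N *.
- rewrite T_0 big_cons mixp_0 gauss_evalCM ler_wpM2l ?IH//; last by lia.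
  by rewrite addr_ge0 ?exprn_ge0.
rewrite T_S; apply: le_trans (loop_supersolution k ks); rewrite !lerD//.
- by rewrite ler_wpM2l ?mulr_ge0// IH//=; lia.
- by apply: ler_sum => a _; rewrite IH//=; have := ltn_ord a; lia.
- by rewrite ler_wpM2l// IH//=; lia.
rewrite ler_wpM2l//; apply: ler_selsum => s1 l s2 e.
rewrite ler_wpM2l// IH//=; move: le_N.
by rewrite e !(sumn_cat, size_cat)/=; lia.
Qed.

End LoopEquation.

(** * Traces as sums over closed walks *)

Section FormalSums.
Variables (R : realDomainType) (W : Type).
Implicit Types (s : seq (R * W)).

(* [wsum s F] is the value of the linear form [F] on the formal linear
   combination [s]. *)
Definition wsum s (F : W -> R) : R := \sum_(p <- s) p.1 * F p.2.

Lemma eq_wsum s F G : F =1 G -> wsum s F = wsum s G.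
Proof. by move=> FG; apply: eq_bigr => p _; rewrite FG. Qed.

Lemma wsumD s F G : wsum s (fun w => F w + G w) = wsum s F + wsum s G.
Proof. by rewrite /wsum -big_split; apply: eq_bigr => p _; rewrite mulrDr. Qed.

Lemma wsumZ s a F : wsum s (fun w => a * F w) = a * wsum s F.
Proof. by rewrite /wsum mulr_sumr; apply: eq_bigr => p _; rewrite mulrCA. Qed.

Lemma wsum_sum s (I : Type) (r : seq I) (F : I -> W -> R) :
  wsum s (fun w => \sum_(i <- r) F i w) = \sum_(i <- r) wsum s (F i).
Proof.
by rewrite /wsum exchange_big; apply: eq_bigr => p _; rewrite mulr_sumr.
Qed.

Lemma wsum_selsum s (X : Type) (r : seq X) (F : X -> seq X -> W -> R) :
  wsum s (fun w => selsum r (fun x t => F x t w)) =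
  selsum r (fun x t => wsum s (F x t)).
Proof.
elim: r F => [|x r IH] F /=; first by apply: big1 => p _; rewrite mulr0.
by rewrite wsumD IH.
Qed.

Lemma ler_wsum s F G : all (fun p => 0 <= p.1) s -> (forall w, F w <= G w) ->
  wsum s F <= wsum s G.
Proof.
rewrite /wsum => s0 FG; elim: s s0 => [|p s IH] /=; first by rewrite !big_nil.
by move=> /andP[p0 s0]; rewrite !big_cons lerD ?ler_wpM2l// IH.
Qed.

End FormalSums.

Lemma wsum_exchange (R : realDomainType) (W W' : Type) (s : seq (R * W))
    (s' : seq (R * W')) (F : W -> W' -> R) :
  wsum s (fun w => wsum s' (F w)) = wsum s' (fun w' => wsum s (F^~ w')).
Proof.
rewrite /wsum; under eq_bigr do rewrite mulr_sumr.
rewrite exchange_big; apply: eq_bigr => p _; rewrite mulr_sumr.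
by apply: eq_bigr => p' _; rewrite mulrCA.
Qed.

Section Walks.
Variables (R : realDomainType) (n : nat).
Local Notation edge := ('I_n * 'I_n)%type.
Implicit Types (i j x y z : 'I_n) (w : seq edge) (F : seq edge -> R).

(* The expansion of the [(i, j)] entry of [(Y + d) ^+ k] in monomials in the
   entries of [Y]. *)
Fixpoint walk (d : R) k i j : seq (R * seq edge) :=
  if k is k'.+1 then
    [seq (d * p.1, p.2) | p <- walk d k' i j] ++
    flatten [seq [seq (p.1, (i, x) :: p.2) | p <- walk d k' x j] | x <- enum 'I_n]
  else [:: ((i == j)%:R, [::])].

(* The expansion of the product over [k] in [ks] of the traces of
   [(Y + d) ^+ k]. *)
Fixpoint loop (d : R) (ks : seq nat) : seq (R * seq edge) :=
  if ks is k :: ks' then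
    flatten [seq [seq (p.1 * p'.1, p.2 ++ p'.2) | p <- walk d k i i, p' <- loop d ks']
            | i <- enum 'I_n]
  else [:: (1, [::])].

Arguments walk d k i j : simpl never.
Arguments loop d ks : simpl never.

Variable d : R.
Local Notation walks := (walk d).
Local Notation loops := (loop d).

Lemma walks0 i j F : wsum (walks 0 i j) F = (i == j)%:R * F [::].
Proof. by rewrite /wsum big_seq1. Qed.

Lemma walksS k i j F : wsum (walks k.+1 i j) F =
  d * wsum (walks k i j) F + \sum_x wsum (walks k x j) (fun w => F ((i, x) :: w)).
Proof.
rewrite /wsum big_cat big_map/= mulr_sumr; congr (_ + _).
  by apply: eq_bigr => p _; rewrite mulrA.
rewrite big_flatten big_map big_enum/=; apply: eq_bigr => x _.
by rewrite big_map.
Qed.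

Lemma loops_nil F : wsum (loops [::]) F = F [::].
Proof. by rewrite /wsum big_seq1 mul1r. Qed.

Lemma loops_cons k ks F : wsum (loops (k :: ks)) F =
  \sum_i wsum (walks k i i) (fun w => wsum (loops ks) (fun w' => F (w ++ w'))).
Proof.
rewrite /wsum big_flatten big_map big_enum/=; apply: eq_bigr => i _.
rewrite big_allpairs_dep/=; apply: eq_bigr => p _; rewrite mulr_sumr.
by apply: eq_bigr => p' _; rewrite mulrA.
Qed.

Lemma walks_cat a b i j F :
  \sum_x wsum (walks a i x) (fun w => wsum (walks b x j) (fun w' => F (w ++ w')))
  = wsum (walks (a + b) i j) F.
Proof.
elim: a i F => [|a IH] i F.
  under eq_bigr do rewrite walks0.
  by rewrite (bigD1 i)//= eqxx mul1r big1 ?addr0// => x /negbTE; rewrite eq_sym => ->; rewrite mul0r.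
under eq_bigr do rewrite walksS.
rewrite big_split/= addSn walksS -mulr_sumr IH; congr (_ + _).
by rewrite exchange_big; apply: eq_bigr => x _; rewrite -IH.
Qed.

Lemma walksSr k i j F : wsum (walks k.+1 i j) F =
  d * wsum (walks k i j) F +
  \sum_x wsum (walks k i x) (fun w => F (rcons w (x, j))).
Proof.
have walks1 x G : wsum (walks 1 x j) G = (x == j)%:R * (d * G [::]) + G [:: (x, j)].
  rewrite walksS walks0 (bigD1 j)//= walks0 eqxx mul1r mulrCA big1 ?addr0//.
  by move=> y /negbTE yj; rewrite walks0 yj mul0r.
rewrite -addn1 -walks_cat.
transitivity (\sum_x ((x == j)%:R * (d * wsum (walks k i x) F) +
    wsum (walks k i x) (fun w => F (rcons w (x, j))))).
  apply: eq_bigr => x _; rewrite -!wsumZ -wsumD; apply: eq_wsum => w.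
  by rewrite walks1 cats0 cats1.
rewrite big_split/=; congr (_ + _); rewrite (bigD1 j)//= eqxx mul1r big1 ?addr0//.
by move=> x /negbTE xj; rewrite xj mul0r.
Qed.

Definition eswap (e : edge) : edge := (e.2, e.1).

Lemma walks_rev k i j F :
  wsum (walks k i j) F = wsum (walks k j i) (fun w => F (rev (map eswap w))).
Proof.
elim: k i j F => [|k IH] i j F; first by rewrite !walks0 eq_sym.
rewrite walksS walksSr -IH; congr (_ + _); apply: eq_bigr => x _.
rewrite IH; apply: eq_wsum => w.
by rewrite map_rcons rev_rcons.
Qed.

(** Noncommutative Leibniz rule: the edge can be removed at any of the [k] factors [Y + d], which
    leaves the walks before and after it. *)
Lemma walks_selsum k i j (G : edge -> seq edge -> R) :
  wsum (walks k i j) (fun w => selsum w G) =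
  \sum_(a < k) \sum_x \sum_y wsum (walks a i x)
    (fun w => wsum (walks (k.-1 - a) y j) (fun w' => G (x, y) (w ++ w'))).
Proof.
elim: k i G => [|k IH] i G; first by rewrite walks0 big_ord0 mulr0.
rewrite walksS /= big_ord_recl/= subn0.
under eq_bigr do rewrite wsumD IH.
rewrite big_split/= addrCA; congr (_ + _).
  rewrite [RHS](bigD1 i)//= [X in _ + X]big1 ?addr0 => [|x /negbTE xi].
    by apply: eq_bigr => y _; rewrite walks0 eqxx mul1r.
  by rewrite big1// => y _; rewrite walks0 eq_sym xi mul0r.
rewrite IH mulr_sumr [X in _ + X = _]exchange_big -big_split/=; apply: eq_bigr => a _.
rewrite mulr_sumr [X in _ + X = _]exchange_big -big_split/=; apply: eq_bigr => x _.
rewrite mulr_sumr [X in _ + X = _]exchange_big -big_split/=; apply: eq_bigr => y _.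
have -> : (k - bump 0 a = k.-1 - a)%N by rewrite /bump; have := ltn_ord a; lia.
by rewrite /bump/= add1n walksS.
Qed.

(** A loop cut at an edge can be read from the cut onwards, so its [l] factors contribute equally;
    this rotation is why [K] has to be invariant under permutation. *)
Lemma loops_selsum ks (K : edge -> seq edge -> R) :
  (forall e w w', perm_eq w w' -> K e w = K e w') ->
  wsum (loops ks) (fun w => selsum w K) =
  selsum ks (fun l t => l%:R * \sum_y \sum_z wsum (walks l.-1 z y)
    (fun w => wsum (loops t) (fun w' => K (y, z) (w ++ w')))).
Proof.
elim: ks K => [|l ks IH] K Kperm; first by rewrite loops_nil.
rewrite loops_cons.
under eq_bigr => i _.
  under eq_wsum => w.
    under eq_wsum => w' do rewrite selsum_cat.
    rewrite wsumD wsum_selsum IH; last first.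
      by move=> e u u' uu'; apply: Kperm; rewrite perm_cat2l.
    over.
  rewrite wsumD walks_selsum wsum_selsum.
  over.
rewrite big_split/=; congr (_ + _).
  rewrite exchange_big/= mulr_natl -[X in _ *+ X]card_ord -sumr_const.
  apply: eq_bigr => a _; rewrite exchange_big; apply: eq_bigr => y _.
  rewrite exchange_big; apply: eq_bigr => z _.
  have e : l.-1 = ((l.-1 - a) + a)%N by have := ltn_ord a; lia.
  rewrite [in RHS]e -walks_cat; apply: eq_bigr => i _; rewrite wsum_exchange.
  apply: eq_wsum => u; apply: eq_wsum => v; apply: eq_wsum => w.
  by apply: Kperm; rewrite perm_cat2r perm_catC.
rewrite -selsum_sum; apply: eq_selsum => s1 l' s2 _ /=.
under eq_bigr do rewrite wsumZ.
rewrite -mulr_sumr; congr (_ * _).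
transitivity (\sum_i \sum_y \sum_z wsum (walks l i i) (fun w =>
    wsum (walks l'.-1 z y) (fun w1 =>
      wsum (loops (s1 ++ s2)) (fun w2 => K (y, z) (w ++ w1 ++ w2))))).
  by apply: eq_bigr => i _; rewrite wsum_sum; apply: eq_bigr => y _; rewrite wsum_sum.
rewrite exchange_big; apply: eq_bigr => y _.
rewrite exchange_big; apply: eq_bigr => z _.
under [in RHS]eq_wsum do rewrite loops_cons.
rewrite wsum_sum; apply: eq_bigr => i _; rewrite wsum_exchange.
apply: eq_wsum => u; apply: eq_wsum => v; apply: eq_wsum => w.
by apply: Kperm; rewrite perm_catCA.
Qed.

End Walks.
Arguments eswap {n} e.
Arguments walk {R n} d k i j : simpl never.
Arguments loop {R n} d ks : simpl never.

(** * Gaussian words and loop equations of the GOE *)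

Section GaussianWords.
Variables (R : realFieldType) (n : nat) (b : 'M[R]_n).
Local Notation edge := ('I_n * 'I_n)%type.
Implicit Types (e f p : edge) (w t : seq edge).

(** Picks the representative of an undirected edge in the triangle that indexes the independent
    entries. *)
Definition ecanon e : edge := if (e.2 <= e.1)%N then e else eswap e.

Definition entry_var p : R :=
  if p.1 == p.2 then 2 * b p.1 p.1 ^+ 2 else b p.1 p.2 ^+ 2.

(* The expectation of the product over the edges [(i, j)] of [w] of the entries
   [X i j] of a symmetric matrix with independent centered Gaussian entries of
   variances [b i j ^+ 2], doubled on the diagonal. *)
Definition gword w : R :=
  \prod_(p : edge | (p.2 <= p.1)%N)
    gmom (entry_var p) (count (fun e => ecanon e == p) w).

(** Covariance of two entries. On the diagonal both indicators are 1: the factor [Num.sqrt 2] in the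
    model is what makes this formula, hence each contraction, uniform. *)
Definition ecov e f : R := b e.1 e.2 ^+ 2 * ((e == f)%:R + (e == eswap f)%:R).

Lemma eswapK : involutive (@eswap n).
Proof. by case. Qed.

Lemma ecanon_swap e : ecanon (eswap e) = ecanon e.
Proof.
case: e => i j; rewrite /ecanon /=; case: ltngtP => // ij.
by rewrite /eswap/=; congr pair; apply: val_inj.
Qed.

Lemma ecanon_le e : ((ecanon e).2 <= (ecanon e).1)%N.
Proof. by rewrite /ecanon; case: ifP => //= /negbT; rewrite -ltnNge => /ltnW. Qed.

Lemma gword_perm w w' : perm_eq (map ecanon w) (map ecanon w') -> gword w = gword w'.
Proof.
move=> /permP ww'; apply: eq_bigr => p _; congr gmom.
by have := ww' (pred1 p); rewrite !count_map.
Qed.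

Lemma gword_ge0 w : 0 <= gword w.
Proof.
apply: prodr_ge0 => p _; apply: gmom_ge0; rewrite /entry_var.
by case: ifP => _; [apply: mulr_ge0 => //|]; exact: sqr_ge0.
Qed.

Lemma gword_nil : gword [::] = 1.
Proof. by rewrite /gword big1. Qed.

Hypothesis b_sym : forall i j, b i j = b j i.

Lemma ecovE e f :
  ecov e f = if ecanon e == ecanon f then entry_var (ecanon e) else 0.
Proof.
have -> : (ecanon e == ecanon f) = (e == f) || (e == eswap f).
  apply/eqP/orP => [|[/eqP->//|/eqP->]]; last by rewrite ecanon_swap.
  rewrite /ecanon; case: ifP => _; case: ifP => _ ef.
  - by left; rewrite ef.
  - by right; rewrite ef.
  - by right; rewrite -ef eswapK.
  - by left; rewrite -(eswapK e) ef eswapK.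
have v_e : entry_var (ecanon e) = entry_var e.
  rewrite /ecanon; case: ifP => // _; rewrite /entry_var /= eq_sym.
  by case: eqP => [->//|_]; rewrite b_sym.
rewrite v_e /ecov; have [-> /=|ne_ef] := eqVneq e f.
  case: f {v_e} => i j; rewrite /entry_var /eswap /=.
  have -> : ((i, j) == (j, i)) = (i == j).
    by rewrite xpair_eqE [j == i]eq_sym andbb.
  by case: eqP => [->|_] /=; ring.
have [ef|] /= := eqVneq e (eswap f); last by rewrite addr0 mulr0.
rewrite add0r mulr1 /entry_var ifF//; apply: contra_neqF ne_ef => /eqP e12.
by move: ef e12; case: e v_e => i j _; case: f => k l [-> ->] /= ->.
Qed.

Lemma selsum_count (a : pred edge) w (c : R) :
  selsum w (fun f _ => (if a f then c else 0) : R) = (count a w)%:R * c.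
Proof.
elim: w => [|f w IH] /=; first by rewrite mul0r.
by rewrite IH natrD mulrDl; case: (a f); rewrite ?mul1r ?mul0r.
Qed.

(* Wick's formula. *)
Lemma gword_cons e w :
  gword (e :: w) = selsum w (fun f t => ecov e f * gword t).
Proof.
set c := ecanon e; set m := count (fun f => ecanon f == c) w.
set rest := \prod_(p : edge | (p.2 <= p.1)%N && (p != c))
  gmom (entry_var p) (count (fun f => ecanon f == p) w).
have gE u : gword u = gmom (entry_var c) (count (fun f => ecanon f == c) u) *
    \prod_(p : edge | (p.2 <= p.1)%N && (p != c))
      gmom (entry_var p) (count (fun f => ecanon f == p) u).
  by rewrite /gword (bigD1 c) ?ecanon_le.
transitivity (selsum w (fun f _ => if ecanon f == c then
    entry_var c * gmom (entry_var c) m.-1 * rest else 0)); last first.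
  apply: eq_selsum => s1 f s2 w_s; rewrite ecovE -/c [c == _]eq_sym.
  case: eqP => [fc|]; last by rewrite mul0r.
  rewrite gE -!mulrA; congr (_ * (gmom _ _ * _)).
    by rewrite /m w_s !count_cat /= fc eqxx addnCA add1n.
  apply: eq_bigr => p /andP[_ /negbTE pc]; congr gmom.
  by rewrite w_s !count_cat /= fc [c == p]eq_sym pc.
(* The [m] matching letters give equal terms, which accounts for the factor [m] in the recurrence of
   the Gaussian moments. *)
rewrite (selsum_count (fun f => ecanon f == c)) -/m gE /= -/c eqxx add1n gmomS.
rewrite [_ * m%:R]mulrC -!mulrA; congr (_ * (_ * (_ * _))).
by apply: eq_bigr => p /andP[_ /negbTE pc]; rewrite /= -/c [c == p]eq_sym pc.
Qed.

End GaussianWords.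
Arguments ecanon {n} e.

Section GOE.
Variables (R : realFieldType) (n : nat) (d : R).
Local Notation edge := ('I_n * 'I_n)%type.
Local Notation G := (gword (const_mx 1 : 'M[R]_n)).

Definition goe_trace (ks : seq nat) : R := wsum (loop d ks) G.

Lemma ecov_goe i x y z (c : R) :
  ecov (const_mx 1 : 'M[R]_n) (i, x) (y, z) * c =
  ((y == i) && (z == x))%:R * c + ((y == x) && (z == i))%:R * c.
Proof.
rewrite /ecov mxE expr1n mul1r mulrDl !xpair_eqE.
by rewrite ![i == _]eq_sym ![x == _]eq_sym [(z == i) && _]andbC.
Qed.

Lemma sum_pick2 (a c : 'I_n) (F : 'I_n -> 'I_n -> R) :
  \sum_y \sum_z ((y == a) && (z == c))%:R * F y z = F a c.
Proof.
rewrite (bigD1 a)//= [X in _ + X]big1 ?addr0 => [|y /negbTE ya].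
  by rewrite (bigD1 c)//= !eqxx mul1r big1 ?addr0// => z /negbTE ->; rewrite andbF mul0r.
by apply: big1 => z _; rewrite ya mul0r.
Qed.

Lemma sum_ecov_goe i x (F : 'I_n -> 'I_n -> R) :
  \sum_y \sum_z ecov (const_mx 1 : 'M[R]_n) (i, x) (y, z) * F y z = F i x + F x i.
Proof.
rewrite -(sum_pick2 i x) -(sum_pick2 x i) -big_split; apply: eq_bigr => y _.
by rewrite -big_split; apply: eq_bigr => z _; rewrite ecov_goe.
Qed.

Lemma gword_rev (w w1 w2 : seq edge) :
  G (w1 ++ rev (map eswap w) ++ w2) = G (w1 ++ w ++ w2).
Proof.
apply: gword_perm; rewrite !map_cat perm_cat2l perm_cat2r map_rev perm_rev.
by rewrite -map_comp (eq_map (g := ecanon)) => [|e]; rewrite /= ?ecanon_swap.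
Qed.

Lemma goe_trace_nil : goe_trace [::] = 1.
Proof. by rewrite /goe_trace loops_nil gword_nil. Qed.

Lemma goe_trace1E k : goe_trace [:: k] =
  \sum_i wsum (walk d k i i) G.
Proof.
rewrite /goe_trace loops_cons; apply: eq_bigr => i _; apply: eq_wsum => w.
by rewrite loops_nil cats0.
Qed.

Lemma goe_trace0 ks : goe_trace (0%N :: ks) = n%:R * goe_trace ks.
Proof.
rewrite /goe_trace loops_cons.
under eq_bigr do rewrite walks0 eqxx mul1r.
by rewrite sumr_const card_ord mulr_natl.
Qed.

(** Wick's formula is applied to the first edge of the first loop. A partner in the same loop either
    splits it or, matched in the other direction, reverses a segment and leaves one loop of length
    [k.-1]. A partner in a loop of length [l] merges the two loops in either direction, whence the
    factor 2. *)
Lemma goe_traceS k ks : goe_trace (k.+1 :: ks) =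
  d * goe_trace (k :: ks) + \sum_(a < k) goe_trace [:: nat_of_ord a, (k.-1 - a)%N & ks]
  + k%:R * goe_trace (k.-1 :: ks)
  + 2 * selsum ks (fun l t => l%:R * goe_trace ((k + l.-1)%N :: t)).
Proof.
(* [H] collects the partners in the first loop, [H'] those in the other loops. *)
pose H i x (w w' : seq edge) :=
  selsum w (fun f t => ecov (const_mx 1) (i, x) f * G (t ++ w')).
pose H' i x (w w' : seq edge) :=
  selsum w' (fun f t => ecov (const_mx 1) (i, x) f * G (w ++ t)).
have split_cons i x w w' : G ((i, x) :: w ++ w') = H i x w w' + H' i x w w'.
  by rewrite gword_cons ?selsum_cat// => a c; rewrite !mxE.
have -> : goe_trace (k.+1 :: ks) = d * goe_trace (k :: ks)
  + \sum_i \sum_x wsum (walk d k x i) (fun w => wsum (loop d ks) (H i x w))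
  + \sum_i \sum_x wsum (walk d k x i) (fun w => wsum (loop d ks) (H' i x w)).
  rewrite /goe_trace !loops_cons mulr_sumr -!big_split; apply: eq_bigr => i _ /=.
  rewrite walksS -addrA -big_split; congr (_ + _); apply: eq_bigr => x _ /=.
  rewrite -wsumD; apply: eq_wsum => w; rewrite -wsumD; apply: eq_wsum => w'.
  exact: split_cons.
rewrite -!addrA; congr (_ + _); rewrite addrA; congr (_ + _).
  have step i x : wsum (walk d k x i) (fun w => wsum (loop d ks) (H i x w)) =
    \sum_(a < k) (wsum (walk d a x i) (fun w => wsum (walk d (k.-1 - a) i x)
        (fun w1 => wsum (loop d ks) (fun w2 => G ((w ++ w1) ++ w2))))
      + wsum (walk d a x x) (fun w => wsum (walk d (k.-1 - a) i i)
        (fun w1 => wsum (loop d ks) (fun w2 => G (w ++ w1 ++ w2))))).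
    rewrite /H; under eq_wsum do rewrite wsum_selsum.
    rewrite walks_selsum; apply: eq_bigr => a _.
    transitivity (\sum_y \sum_z ecov (const_mx 1 : 'M[R]_n) (i, x) (y, z) *
      wsum (walk d a x y) (fun w => wsum (walk d (k.-1 - a) z i)
        (fun w1 => wsum (loop d ks) (fun w2 => G (w ++ w1 ++ w2))))).
      apply: eq_bigr => y _; apply: eq_bigr => z _; rewrite -wsumZ.
      apply: eq_wsum => w; rewrite -wsumZ; apply: eq_wsum => w1; rewrite -wsumZ.
      by apply: eq_wsum => w2; rewrite catA.
    rewrite sum_ecov_goe; congr (_ + _); apply: eq_wsum => w.
    rewrite walks_rev; apply: eq_wsum => w1; apply: eq_wsum => w2.
    by rewrite gword_rev catA.
  under eq_bigr do under eq_bigr do rewrite step big_split.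
  transitivity (\sum_(a < k) (goe_trace (k.-1 :: ks) + goe_trace [:: nat_of_ord a, (k.-1 - a)%N & ks])).
    under eq_bigr do rewrite big_split.
    rewrite big_split [RHS]big_split /=; congr (_ + _).
      rewrite exchange_big /=; under eq_bigr do rewrite exchange_big.
      rewrite exchange_big; apply: eq_bigr => a _; rewrite /goe_trace loops_cons.
      apply: eq_bigr => x _.
      rewrite (walks_cat d a (k.-1 - a) x x
        (fun u => wsum (loop d ks) (fun w2 => G (u ++ w2)))).
      by rewrite subnKC//; have := ltn_ord a; lia.
    under eq_bigr do rewrite exchange_big.
    rewrite exchange_big; apply: eq_bigr => a _; rewrite /goe_trace loops_cons.
    rewrite exchange_big; apply: eq_bigr => x _.
    by rewrite -wsum_sum; apply: eq_wsum => w; rewrite loops_cons.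
  by rewrite big_split/= sumr_const card_ord mulr_natl addrC.
have step i x : wsum (walk d k x i) (fun w => wsum (loop d ks) (H' i x w)) =
  selsum ks (fun l t => l%:R *
   (wsum (walk d k x i) (fun w => wsum (walk d l.-1 i x)
     (fun w1 => wsum (loop d t) (fun w2 => G ((w ++ w1) ++ w2)))) *+ 2)).
  transitivity (wsum (walk d k x i) (fun w =>
      selsum ks (fun l t => l%:R *
        (wsum (walk d l.-1 i x)
           (fun w1 => wsum (loop d t) (fun w2 => G ((w ++ w1) ++ w2))) *+ 2)))).
    apply: eq_wsum => w; rewrite /H' loops_selsum; last first.
      move=> e u u' uu'; congr (_ * _); apply: gword_perm.
      by rewrite perm_map// perm_cat2l.
    apply: eq_selsum => s1 l s2 _; congr (_ * _).
    transitivity (\sum_y \sum_z ecov (const_mx 1 : 'M[R]_n) (i, x) (y, z) *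
      wsum (walk d l.-1 z y) (fun w1 => wsum (loop d (s1 ++ s2))
        (fun w2 => G (w ++ w1 ++ w2)))).
      apply: eq_bigr => y _; apply: eq_bigr => z _; rewrite -wsumZ.
      by apply: eq_wsum => w1; rewrite -wsumZ.
    rewrite sum_ecov_goe mulr2n; congr (_ + _).
      rewrite walks_rev; apply: eq_wsum => w1; apply: eq_wsum => w2.
      by rewrite gword_rev catA.
    by apply: eq_wsum => w1; apply: eq_wsum => w2; rewrite catA.
  rewrite wsum_selsum; apply: eq_selsum => s1 l s2 _.
  by rewrite wsumZ mulr2n -wsumD; congr (_ * _); apply: eq_wsum => w; rewrite mulr2n.
under eq_bigr do under eq_bigr do rewrite step.
rewrite mulr_selsumr.
under eq_bigr do rewrite -selsum_sum.
rewrite -selsum_sum; apply: eq_selsum => s1 l s2 _.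
rewrite mulrCA; under eq_bigr do rewrite -mulr_sumr.
rewrite -mulr_sumr; congr (_ * _); rewrite /goe_trace loops_cons exchange_big mulr_sumr.
apply: eq_bigr => x _; rewrite -(walks_cat d k l.-1 x x
  (fun u => wsum (loop d (s1 ++ s2)) (fun w2 => G (u ++ w2)))) mulr_sumr.
by apply: eq_bigr => i _; rewrite mulr_natl.
Qed.

End GOE.

(** * Truncated exponential generating functions *)

Section BinomialTransform.
Variable R : realFieldType.
Implicit Types (a x : R) (W : nat -> R).

(** The moments of a law translated by [a], in terms of its moments [W]. *)
Definition bintrans a W k : R := \sum_(m < k.+1) 'C(k, m)%:R * a ^+ (k - m) * W m.

Lemma bintransS a W k :
  bintrans a W k.+1 = a * bintrans a W k + bintrans a (fun m => W m.+1) k.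
Proof.
rewrite /bintrans big_ord_recl bin0 subn0 mul1r.
under eq_bigr do rewrite lift0 binS subSS natrD !mulrDl.
rewrite big_split/= [X in _ + (X + _)]big_ord_recr/= bin_small// !mul0r addr0.
rewrite addrA; congr (_ + _); rewrite [X in _ = a * X]big_ord_recl bin0 subn0 mul1r.
rewrite mulrDr mulrA exprS mulr_sumr; congr (_ + _); apply: eq_bigr => i _.
have lt_ik := ltn_ord i; rewrite lift0.
have -> : (k - i = (k - i.+1).+1)%N by lia.
by rewrite exprS; ring.
Qed.

Lemma bintrans_sum a k (I : Type) (r : seq I) (F : I -> nat -> R) :
  bintrans a (fun m => \sum_(i <- r) F i m) k = \sum_(i <- r) bintrans a (F i) k.
Proof.
rewrite /bintrans exchange_big; apply: eq_bigr => m _.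
by rewrite mulr_sumr.
Qed.

Definition egf x W N : R := \sum_(k < N) x ^+ k / k`!%:R * W k.

Lemma egf_ge0 x W N : 0 <= x -> (forall k, 0 <= W k) -> 0 <= egf x W N.
Proof.
by move=> x0 W0; apply: sumr_ge0 => k _; rewrite mulr_ge0// divr_ge0 ?exprn_ge0.
Qed.

Lemma egf_le x W W' N : 0 <= x -> (forall k, W k <= W' k) -> egf x W N <= egf x W' N.
Proof.
move=> x0 WW'; apply: ler_sum => k _; rewrite ler_wpM2l//.
by rewrite divr_ge0 ?exprn_ge0.
Qed.

Lemma leq_egf x W N M : 0 <= x -> (forall k, 0 <= W k) -> (N <= M)%N ->
  egf x W N <= egf x W M.
Proof.
move=> x0 W0 /subnKC <-; rewrite /egf big_split_ord/= lerDl sumr_ge0// => k _.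
by rewrite mulr_ge0// divr_ge0 ?exprn_ge0.
Qed.

Lemma triangular_sum (f g : nat -> R) K :
  \sum_(k < K) \sum_(m < k.+1) f (k - m)%N * g m =
  \sum_(m < K) g m * \sum_(i < K - m) f i.
Proof.
elim: K => [|K IH]; first by rewrite !big_ord0.
rewrite big_ord_recr IH [in RHS]big_ord_recr/= subSnn big_ord1.
rewrite [X in _ + X = _]big_ord_recr/= subnn addrA [f 0%N * _]mulrC; congr (_ + _).
rewrite -big_split/=; apply: eq_bigr => m _; rewrite subSn; last by have := ltn_ord m; lia.
by rewrite big_ord_recr/= mulrDr [f _ * _]mulrC.
Qed.

(** Translation by [a] multiplies the full series by exp (a x). Truncation leaves a triangle of
    indices; the next two bounds place it inside a square, or a rectangle inside it. *)
Lemma egf_bintrans a x W K : egf x (bintrans a W) K =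
  \sum_(m < K) x ^+ m / m`!%:R * W m * egf (a * x) (fun=> 1) (K - m).
Proof.
rewrite /egf /bintrans.
under [RHS]eq_bigr do under eq_bigr do rewrite mulr1.
rewrite -(triangular_sum (fun i => (a * x) ^+ i / i`!%:R)
  (fun m => x ^+ m / m`!%:R * W m)).
apply: eq_bigr => k _; rewrite mulr_sumr; apply: eq_bigr => m _.
have le_mk : (m <= k)%N by have := ltn_ord m; lia.
have nz j : j`!%:R != 0 :> R by rewrite pnatr_eq0 -lt0n fact_gt0.
rewrite -(bin_fact le_mk) !natrM exprMn -[in x ^+ k](subnK le_mk) exprD.
have bnz : 'C(k, m)%:R != 0 :> R by rewrite pnatr_eq0 -lt0n bin_gt0.
by field; rewrite !nz bnz.
Qed.

Lemma egf_bintrans_le a x W K : 0 <= a -> 0 <= x -> (forall k, 0 <= W k) ->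
  egf x (bintrans a W) K <= egf (a * x) (fun=> 1) K * egf x W K.
Proof.
move=> a0 x0 W0; rewrite egf_bintrans [leRHS]mulrC mulr_suml; apply: ler_sum => m _.
rewrite ler_wpM2l ?mulr_ge0 ?divr_ge0 ?exprn_ge0//.
by apply: leq_egf; rewrite ?mulr_ge0// leq_subr.
Qed.

Lemma egf_bintrans_ge a x W K N : 0 <= a -> 0 <= x -> (forall k, 0 <= W k) ->
  egf (a * x) (fun=> 1) K * egf x W N <= egf x (bintrans a W) (N + K).
Proof.
move=> a0 x0 W0; rewrite egf_bintrans [leLHS]mulrC mulr_suml big_split_ord/=.
rewrite -[leLHS]addr0; apply: lerD; last first.
  apply: sumr_ge0 => m _; rewrite !mulr_ge0 ?invr_ge0 ?exprn_ge0//.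
  by apply: egf_ge0; rewrite ?mulr_ge0.
apply: ler_sum => m _; rewrite ler_wpM2l ?mulr_ge0 ?divr_ge0 ?exprn_ge0//.
by apply: leq_egf; rewrite ?mulr_ge0//; have := ltn_ord m; lia.
Qed.

(** The moment of order 2 j is (2 j)! / j! and odd moments vanish, so the series truncated at
    [N + N] is that of exp (x^2) truncated at [N]. *)
Lemma egf_gmom2_le x N : 0 <= x -> egf x (gmom 2) N <= egf (x ^+ 2) (fun=> 1) N.
Proof.
move=> x0; apply: (@le_trans _ _ (egf x (gmom 2) (N + N)%N)).
  by apply: leq_egf; rewrite ?leq_addr// => k; rewrite gmom_ge0.
elim: N => [|N IH]; first by rewrite /egf !big_ord0.
have gE j : gmom 2 j.*2 = (j.*2)`!%:R / j`!%:R :> R.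
  elim: j => [|j IHj]; first by rewrite /= divff.
  rewrite doubleS gmomS succnK IHj (factS j.*2.+1) (factS j.*2) (factS j) !natrM.
  have nz : j`!%:R != 0 :> R by rewrite pnatr_eq0 -lt0n fact_gt0.
  have nz' : j.+1%:R != 0 :> R by rewrite pnatr_eq0.
  by rewrite -(doubleS j) -(mul2n j.+1) (natrM _ 2); field; rewrite nz nat1r.
have gO j : gmom 2 j.*2.+1 = 0 :> R.
  by elim: j => [|j IHj] //; rewrite doubleS gmomS succnK IHj mulr0.
rewrite addnS addSn /egf big_ord_recr/= big_ord_recr/= [leRHS]big_ord_recr/=.
have nz j : j`!%:R != 0 :> R by rewrite pnatr_eq0 -lt0n fact_gt0.
rewrite addnn gO mulr0 addr0 -addnn; apply: lerD => //.
rewrite addnn gE mulr1 -mul2n exprM le_eqVlt; apply/orP; left; apply/eqP.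
by field; rewrite !nz.
Qed.

End BinomialTransform.

Section ExpR.
Variable R : realType.

Lemma egf1E (x : R) N : egf x (fun=> 1) N = series (exp_coeff x) N.
Proof. by rewrite /series/= big_mkord; apply: eq_bigr => k _; rewrite mulr1. Qed.

Lemma egf1_le_expR (x : R) N : 0 <= x -> egf x (fun=> 1) N <= expR x.
Proof.
move=> x0; rewrite egf1E; apply: nondecreasing_cvgn_le.
  by apply: nondecreasing_series => n _ _; exact: exp_coeff_ge0.
exact: is_cvg_series_exp_coeff.
Qed.

Lemma expR_le_of_egf1 (x c : R) : (forall N, egf x (fun=> 1) N <= c) -> expR x <= c.
Proof.
move=> le_c; apply: limr_le; first exact: is_cvg_series_exp_coeff.
by apply: nearW => N; rewrite -egf1E.
Qed.
End ExpR.

Section GOEMoments.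
Variables (R : realType) (n : nat).

Lemma walk_bintrans (d : R) k (i j : 'I_n) F :
  wsum (walk d k i j) F = bintrans d (fun m => wsum (walk 0 m i j) F) k.
Proof.
elim: k i F => [|k IH] i F.
  by rewrite /bintrans big_ord1 bin0 mul1r expr0 mul1r !walks0.
rewrite walksS bintransS -IH; congr (_ + _).
under [X in _ = bintrans _ X _]funext do rewrite walksS mul0r add0r.
by rewrite bintrans_sum; apply: eq_bigr => x _.
Qed.

Lemma walk_ge0 (d : R) k (i j : 'I_n) : 0 <= d -> all (fun p => 0 <= p.1) (walk d k i j).
Proof.
move=> d0; elim: k i => [|k IH] i; first by rewrite /walk /= ler0n.
apply/allP => p; rewrite /walk -/(@walk R n) mem_cat.
case/orP => [/mapP[p' p'k ->]|/flattenP[s /mapP[x _ ->] /mapP[p' p'k ->]]] /=.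
  by rewrite mulr_ge0// (allP (IH i)).
exact: (allP (IH x)).
Qed.

Lemma goe_trace1_ge0 k : 0 <= goe_trace n (0 : R) [:: k].
Proof.
rewrite goe_trace1E; apply: sumr_ge0 => i _.
rewrite [leLHS](_ : 0 = wsum (walk 0 k i i) (fun=> 0)); last first.
  by rewrite /wsum big1// => p _; rewrite mulr0.
by apply: ler_wsum => [|w]; [exact: walk_ge0|exact: gword_ge0].
Qed.

(* With [q ^+ 2 = n - 1], the trace moments of [Y + 2 q] solve the loop equations,
   and [mixp] is dominated by [n] times its atom at [4 q]; the factor
   [expR (2 q x)] introduced by the shift is then divided out. *)
Lemma goe_mgf (x : R) N : (0 < n)%N -> 0 <= x ->
  egf x (fun k => goe_trace n 0 [:: k]) N <=
  n%:R * expR (2 * Num.sqrt (n.-1)%:R * x + x ^+ 2).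
Proof.
move=> n0 x0; set q := Num.sqrt _.
have q0 : 0 <= q := sqrtr_ge0 _.
have qn : 1 + q ^+ 2 = n%:R by rewrite sqr_sqrtr// addrC natr1 prednK.
set M := fun k => _; have M0 k : 0 <= M k by exact: goe_trace1_ge0.
have shift k : bintrans (2 * q) M k <= n%:R * bintrans (4 * q) (gmom 2) k.
  have -> : bintrans (2 * q) M k = goe_trace n (2 * q) [:: k].
    rewrite goe_trace1E -(eq_bigr _ (fun i _ => esym (walk_bintrans _ _ _ _ _))).
    by rewrite -bintrans_sum; congr bintrans; apply/funext => m; rewrite /M goe_trace1E.
  apply: (@le_trans _ _ (gauss_eval (\prod_(k <- [:: k]) mixp q k))).
    apply: loop_bound => //; first exact: goe_trace_nil.
      by move=> ks; rewrite qn goe_trace0.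
    by move=> ? ?; exact: goe_traceS.
  rewrite big_seq1 -[X in _ <= _ * X](_ : gauss_eval (('X + (4 * q)%:P) ^+ k) = _).
    rewrite -qn -gauss_evalCM; apply: gauss_eval_le.
    have -> : (1 + q ^+ 2)%:P * ('X + (4 * q)%:P) ^+ k - mixp q k =
        (q ^+ 2)%:P * (('X + (4 * q)%:P) ^+ k * smomp q 0 - smomp q (k + 0)).
      by rewrite smomp_0 addn0 /mixp -mul_polyC polyCD; ring.
    apply: nnpolyM; last exact: smomp_le_mul.
    by apply: nnpolyC; exact: exprn_ge0.
  rewrite addrC exprDn linear_sum /bintrans; apply: eq_bigr => i _ /=.
  by rewrite linearMn -polyC_exp /= gauss_evalCM gauss_evalXn -[LHS]mulr_natl mulrA.
have W0 k : 0 <= gmom (2 : R) k by rewrite gmom_ge0.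
have M_ge0 : 0 <= egf x M N by apply: egf_ge0.
set A := egf x M N in M_ge0 *; set Bd := n%:R * _.
(* [K] goes to infinity with [N] fixed: the left factor becomes [expR (2 * q * x)] and can then be
   divided out. *)
have bound K : egf (2 * q * x) (fun=> 1) K * A
    <= n%:R * (expR (4 * q * x) * expR (x ^+ 2)).
  apply: le_trans (egf_bintrans_ge _ _ _ _ _) _; rewrite ?mulr_ge0//.
  apply: le_trans (egf_le _ x0 shift) _.
  have -> W L : egf x (fun k => n%:R * W k) L = n%:R * egf x W L.
    by rewrite /egf mulr_sumr; apply: eq_bigr => k _; rewrite mulrCA.
  rewrite ler_wpM2l//.
  apply: le_trans (egf_bintrans_le _ _ _ _) _; rewrite ?mulr_ge0//.
  apply: ler_pM; rewrite ?egf_ge0 ?mulr_ge0 ?egf1_le_expR ?mulr_ge0//.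
  apply: le_trans (egf_gmom2_le _ x0) _.
  by rewrite egf1_le_expR// exprn_ge0.
have [->|A_neq0] := eqVneq A 0; first by rewrite mulr_ge0// expR_ge0.
have A_gt0 : 0 < A by rewrite lt_def A_neq0.
have : expR (2 * q * x) <= n%:R * (expR (4 * q * x) * expR (x ^+ 2)) / A.
  by apply: expR_le_of_egf1 => K; rewrite ler_pdivlMr.
rewrite ler_pdivlMr// => le1.
rewrite -(ler_pM2l (expR_gt0 (2 * q * x))); apply: le_trans le1 _.
rewrite /Bd [leRHS]mulrCA ler_wpM2l// -!expRD le_eqVlt; apply/orP; left; apply/eqP.
by congr expR; ring.
Qed.

End GOEMoments.

(** * Comparison with the GOE *)

Section Connected.
Variable V : finType.
Implicit Types (E : seq (V * V)).

Definition symrel E : rel V := fun u v => ((u, v) \in E) || ((v, u) \in E).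

Definition graph_connected E := forall u v, connect (symrel E) u v.

Lemma symrel_sym E : symmetric (symrel E).
Proof. by move=> u v; rewrite /symrel orbC. Qed.

Lemma connect_symrelC E : connect_sym (symrel E).
Proof. exact/sym_connect_sym/symrel_sym. Qed.

Lemma sub_connected E E' :
  (forall e, e \in E -> connect (symrel E') e.1 e.2) -> graph_connected E -> graph_connected E'.
Proof.
move=> EE' cE u v; apply: connect_sub (cE u v) => x y /orP[] /EE' //=.
by rewrite connect_symrelC.
Qed.

Lemma connect1_symrel E e : e \in E -> connect (symrel E) e.1 e.2.
Proof. by case: e => u v uvE; apply: connect1; rewrite /symrel uvE. Qed.

Lemma crossing_edge E (A : {set V}) u v : graph_connected E -> u \in A -> v \notin A ->
  exists2 e, e \in E & (e.1 \in A) (+) (e.2 \in A).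
Proof.
move=> cE uA vA; have /connectP[p] := cE u v.
elim: p u uA => [|x p IH] u uA /=; first by move=> _ vu; rewrite vu uA in vA.
case/andP => ux px v_last; have [xA|xA] := boolP (x \in A); first exact: (IH x).
case/orP: ux => ux; first by exists (u, x); rewrite //= uA (negbTE xA).
by exists (x, u); rewrite //= uA (negbTE xA).
Qed.

End Connected.

(** * Spanning trees and sums over labellings *)

Section TreeBound.
Variables (R : realFieldType) (K : finType) (n r : nat) (a : 'I_n -> 'I_n -> R) (s : R).
Hypothesis s_ge0 : 0 <= s.
Hypothesis a_ge0 : forall i j, 0 <= a i j.
Hypothesis a_sym : forall i j, a i j = a j i.
Hypothesis a_le : forall i j, a i j <= s.
Hypothesis a_sum : forall i, \sum_j a i j <= r%:R * s.
Implicit Types (P : seq (K * K)) (A : {set K}).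
Local Notation label := {ffun K -> 'I_n}.

Definition upd (l : label) v x : label := [ffun k => if k == v then x else l k].

Lemma average_label (f : label -> R) u v : u != v -> (forall l, 0 <= f l) ->
  (forall l x, f (upd l v x) = f l) ->
  n%:R * \sum_l f l * a (l u) (l v) <= r%:R * s * \sum_l f l.
Proof.
move=> uv f0 fv.
have -> : n%:R * \sum_l f l * a (l u) (l v) = \sum_l f l * \sum_y a (l u) y.
  rewrite mulr_natl -[X in _ *+ X]card_ord -sumr_const exchange_big pair_big/=.
  (* The involution exchanges the label of [v] with a fresh one, so the factor [n] becomes a free
     sum over the label of [v]. *)
  pose h (p : label * 'I_n) := (upd p.1 v p.2, p.1 v).
  have hK : involutive h.
    case=> l x; rewrite /h /= /upd ffunE eqxx; congr pair.
    by apply/ffunP => k; rewrite !ffunE; case: eqP => [->|].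
  rewrite (reindex_inj (inv_inj hK))/=.
  under [RHS]eq_bigr do rewrite mulr_sumr.
  rewrite pair_big; apply: eq_bigr => -[l x] _ /=.
  by rewrite fv /upd !ffunE eqxx (negbTE uv).
rewrite mulr_sumr; apply: ler_sum => l _; rewrite mulrC ler_wpM2r//.
Qed.

Lemma prod_le_exp (T : eqType) (E : seq T) (p : pred T) (f : T -> R) :
  (forall e, 0 <= f e <= s) -> \prod_(e <- E | p e) f e <= s ^+ count p E.
Proof.
move=> f01; elim: E => [|e E IH]; first by rewrite big_nil.
rewrite big_cons /=; case: (p e) => //; rewrite exprS.
have /andP[f0 fs] := f01 e; apply: ler_pM => //.
by apply: prodr_ge0 => x _; have /andP[] := f01 x.
Qed.

Lemma prod_le_exp1 (T : eqType) (E : seq T) (p : pred T) (f : T -> R) x :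
  (forall e, 0 <= f e <= s) -> x \in E -> p x ->
  \prod_(e <- E | p e) f e <= f x * s ^+ (count p E).-1.
Proof.
move=> f01 /splitPr[E1 E2] px; rewrite big_cat big_cons px/= count_cat/= px.
rewrite addnCA add1n /= mulrCA exprD; have /andP[f0 _] := f01 x.
rewrite ler_wpM2l//; apply: ler_pM; rewrite ?prod_le_exp//.
  by apply: prodr_ge0 => e _; have /andP[] := f01 e.
by apply: prodr_ge0 => e _; have /andP[] := f01 e.
Qed.

Definition inside A (e : K * K) := (e.1 \in A) && (e.2 \in A).

Definition weight P A (l : label) : R :=
  \prod_(e <- P | inside A e) a (l e.1) (l e.2).

Lemma weight_ge0 P A l : 0 <= weight P A l.
Proof. by apply: prodr_ge0 => e _. Qed.

(* A new vertex of the spanning tree costs [r s], which one of the [n] choices of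
   its label pays for; each other new edge costs [s]. *)
Lemma weight_grow P A u v : u \in A -> v \notin A ->
  ((u, v) \in P) || ((v, u) \in P) ->
  n%:R * \sum_l weight P (v |: A) l <=
  r%:R * s ^+ (count (inside (v |: A)) P - count (inside A) P) * \sum_l weight P A l.
Proof.
move=> uA vA uvP; set c := (_ - _)%N.
have uv : u != v by apply: contraNneq vA => <-.
have sub e : inside A e -> inside (v |: A) e.
  by case/andP=> e1 e2; rewrite /inside !inE e1 e2 !orbT.
pose new e := inside (v |: A) e && ~~ inside A e.
have cE : c = count new P.
  have -> : c = (count (inside A) P + count new P - count (inside A) P)%N.
    congr (_ - _)%N; rewrite -(count_predUI (inside A) new).
    rewrite [X in (_ + X)%N](_ : _ = 0%N) ?addn0; last first.
      apply/eqP; rewrite -leqn0 leqNgt -has_count; apply/hasPn => e _ /=.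
      by rewrite /new; case: (inside A e); rewrite ?andbF.
    apply: eq_count => e /=; rewrite /new; have := sub e.
    by case: (inside A e) => [->//|_]; rewrite /= andbT.
  by rewrite addKn.
(* One edge between [u] and [v] is kept for the tree; the other [c.-1] new edges are bounded by
   [s]. *)
have wE l : weight P (v |: A) l <= weight P A l * a (l u) (l v) * s ^+ c.-1.
  rewrite -mulrA /weight (bigID (inside A))/=.
  rewrite (eq_bigl (inside A)) => [|e]; last by rewrite andb_idl//; exact: sub.
  rewrite ler_wpM2l ?weight_ge0// cE.
  have f01 e : 0 <= a (l e.1) (l e.2) <= s by rewrite a_ge0 a_le.
  have new_uv x : x = (u, v) \/ x = (v, u) -> new x.
    by case=> ->; rewrite /new /inside /= !inE eqxx uA (negbTE vA) ?orbT ?andbF.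
  case/orP: uvP => uvP.
    by apply: (@prod_le_exp1 _ P new _ (u, v)) => //; apply: new_uv; left.
  by rewrite a_sym; apply: (@prod_le_exp1 _ P new _ (v, u)) => //; apply: new_uv; right.
have c_gt0 : (0 < c)%N.
  rewrite cE -has_count; apply/hasP; case/orP: uvP => uvP; [exists (u, v)|exists (v, u)] => //.
    by rewrite /new /inside /= !inE eqxx uA (negbTE vA) ?orbT ?andbF.
  by rewrite /new /inside /= !inE eqxx uA (negbTE vA) ?orbT ?andbF.
apply: (@le_trans _ _ (n%:R * \sum_l weight P A l * a (l u) (l v) * s ^+ c.-1)).
  by rewrite ler_wpM2l// ler_sum.
rewrite -mulr_suml mulrA -{2}(prednK c_gt0) exprS.
rewrite [leRHS](_ : _ = r%:R * s * (\sum_l weight P A l) * s ^+ c.-1); last by ring.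
rewrite ler_wpM2r ?exprn_ge0//; apply: average_label => // [l|l x].
  exact: weight_ge0.
apply: eq_bigr => e /andP[e1 e2]; rewrite !ffunE.
by rewrite !ifF//; apply: contraNF vA => /eqP <-.
Qed.

(** A vertex set grows from [k0] along crossing edges until it is all of [K]; each of the [#|K| - 1]
    steps costs a factor [r]. The extra [r] on the left completes them to [r ^+ #|K|], the number of
    labellings by ['I_r]. *)
Lemma tree_bound P (k0 : K) : graph_connected P ->
  r%:R * \sum_l weight P [set: K]%SET l <= n%:R * (s ^+ size P * r%:R ^+ #|K|).
Proof.
move=> cP; have [n0|n_gt0] := posnP n.
  rewrite big1 ?mulr0 ?mulr_ge0 ?exprn_ge0// => l _.
  by suff: (l k0 < 0)%N by []; rewrite -[X in (_ < X)%N]n0.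
(* The labels outside [A] stay free; multiplication by [n%:R ^+ j] replaces a division by [n] at
   each growth step. *)
have grow j : (j < #|K|)%N -> exists A, [/\ #|A| = j.+1, k0 \in A &
    n%:R ^+ j * \sum_l weight P A l <=
    n%:R ^+ #|K| * r%:R ^+ j * s ^+ count (inside A) P].
  elim: j => [|j IH] ltjK.
    exists [set k0]%SET; rewrite cards1 set11; split=> //.
    rewrite !expr0 mul1r mulr1.
    apply: (@le_trans _ _ (\sum_(l : label) s ^+ count (inside [set k0]%SET) P)).
      by apply: ler_sum => l _; apply: prod_le_exp => e; rewrite a_ge0 a_le.
    by rewrite sumr_const card_ffun card_ord -[leLHS]mulr_natl natrX.
  have [A [cA k0A bA]] := IH (ltnW ltjK).
  have [v vA] : exists v, v \notin A.
    apply/existsP; rewrite -negb_forall; apply: contraL ltjK => /forallP AT.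
    rewrite -leqNgt -cA (_ : A = [set: K]%SET) ?cardsT//.
    by apply/finset.setP => x; rewrite inE AT.
  have [u [w [uA wA uwP]]] : exists u w,
      [/\ u \in A, w \notin A & ((u, w) \in P) || ((w, u) \in P)].
    have [[x y] xyP /=] := crossing_edge cP k0A vA.
    case: (boolP (x \in A)) => xA /= yA; first by exists x, y; rewrite xyP.
    by exists y, x; rewrite xyP orbT.
  exists (w |: A); split; first by rewrite cardsU1 wA cA.
    by rewrite inE k0A orbT.
  rewrite exprS mulrAC [X in X <= _]mulrC.
  have le_c : (count (inside A) P <= count (inside (w |: A)) P)%N.
    apply: sub_count => e /andP[e1 e2].
    by rewrite /inside !inE e1 e2 !orbT.
  rewrite -[in s ^+ _](subnK le_c) exprD [r%:R ^+ _]exprS.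
  move: (weight_grow uA wA uwP) bA; set c := (_ - _)%N.
  move: (\sum_l weight P (w |: A) l) (\sum_l weight P A l) => W1 W0 h1 h2.
  apply: (@le_trans _ _ (n%:R ^+ j * (r%:R * s ^+ c * W0))).
    by rewrite ler_wpM2l ?exprn_ge0.
  rewrite mulrCA [leRHS](_ : _ = r%:R * s ^+ c *
    (n%:R ^+ #|K| * r%:R ^+ j * s ^+ count (inside A) P)); last by ring.
  by rewrite ler_wpM2l// mulr_ge0// exprn_ge0.
have K_gt0 : (0 < #|K|)%N by apply/card_gt0P; exists k0.
have [A [cA _ bA]] := grow #|K|.-1 (ltac:(by rewrite prednK)).
have AT : A = [set: K]%SET.
  by apply/eqP; rewrite eqEcard finset.subsetT cardsT cA prednK /=.
move: bA; rewrite AT (_ : count _ P = size P); last first.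
  by rewrite -count_predT; apply: eq_count => e; rewrite /inside !inE.
have eK (x : R) : x ^+ #|K| = x * x ^+ #|K|.-1 by rewrite -exprS prednK.
rewrite [in leRHS]eK => bA; rewrite eK.
have n1 : 0 < n%:R ^+ #|K|.-1 :> R by rewrite exprn_gt0// ltr0n.
rewrite -(ler_pM2l n1) mulrCA.
apply: le_trans (ler_wpM2l (ler0n _ r) bA) _.
by rewrite le_eqVlt; apply/orP; left; apply/eqP; ring.
Qed.

End TreeBound.

Section Quotient.
Variables (V : finType) (Q : seq (V * V)).

Definition respects (m : nat) (l : {ffun V -> 'I_m}) : bool :=
  all (fun e => l e.1 == l e.2) Q.

Definition qclass := {x : V | x \in roots (symrel Q)}.
HB.instance Definition _ := Finite.on qclass.

Definition qcl (v : V) : qclass :=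
  exist _ (fingraph.root (symrel Q) v) (roots_root (connect_symrelC Q) v).

Lemma qcl_eq u v : connect (symrel Q) u v -> qcl u = qcl v.
Proof.
by move=> uv; apply: val_inj; apply/eqP; rewrite /= (root_connect (connect_symrelC Q)).
Qed.

Lemma qclK (k : qclass) : qcl (val k) = k.
Proof. by apply: val_inj; case: k => x /= /eqP. Qed.

Lemma respects_connect m (l : {ffun V -> 'I_m}) u v : respects l ->
  connect (symrel Q) u v -> l u = l v.
Proof.
move=> /allP lQ /connectP[p]; elim: p u => [|x p IH] u /=; first by move=> _ ->.
case/andP=> /orP[] /lQ/= /eqP ux px v_last; first by rewrite ux; exact: IH.
by rewrite -ux; exact: IH.
Qed.

Lemma sum_respects (R : nmodType) m (F : {ffun V -> 'I_m} -> R) :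
  \sum_(l | respects l) F l = \sum_(l : {ffun qclass -> 'I_m}) F [ffun v => l (qcl v)].
Proof.
pose h (l : {ffun qclass -> 'I_m}) : {ffun V -> 'I_m} := [ffun v => l (qcl v)].
pose h' (l : {ffun V -> 'I_m}) : {ffun qclass -> 'I_m} := [ffun k => l (val k)].
rewrite (reindex_onto h h') => [|l lQ]; last first.
  apply/ffunP => v; rewrite !ffunE; apply: (respects_connect lQ).
  by rewrite connect_symrelC connect_root.
apply: eq_bigl => l; apply/andP; split; last first.
  by apply/eqP/ffunP => k; rewrite !ffunE qclK.
apply/allP => e eQ; rewrite !ffunE; apply/eqP; congr (l _).
exact/qcl_eq/connect1_symrel.
Qed.

Lemma connected_quotient P : graph_connected (P ++ Q) ->
  graph_connected [seq (qcl e.1, qcl e.2) | e <- P].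
Proof.
move=> cPQ k k'; rewrite -(qclK k) -(qclK k').
have /connectP[p] := cPQ (val k) (val k').
elim: p (val k) => [|x p IH] u /=; first by move=> _ ->.
case/andP => ux /IH{}IH /IH; apply: connect_trans.
move: ux; rewrite /symrel !mem_cat => ux.
have [uxQ|uxQ] := boolP (symrel Q u x).
  by rewrite (qcl_eq (connect1 uxQ)).
apply: connect1; move: uxQ ux; rewrite /symrel negb_or => /andP[/negbTE -> /negbTE ->].
rewrite !orbF => /orP[] ux; apply/orP; [left|right].
  by apply/mapP; exists (u, x).
by apply/mapP; exists (x, u).
Qed.

End Quotient.

Section Comparison.
Variables (R : realFieldType) (V : finType) (v0 : V) (n r : nat).
Variables (b : 'M[R]_n) (sg : R).
Hypothesis sg_ge0 : 0 <= sg.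
Hypothesis b_sym : forall i j, b i j = b j i.
Hypothesis b_le : forall i j, b i j ^+ 2 <= sg ^+ 2.
Hypothesis b_sum : forall i, \sum_j b i j ^+ 2 <= r%:R * sg ^+ 2.
Implicit Types (P Q U : seq (V * V)).

Definition lword (m : nat) (l : {ffun V -> 'I_m}) U := [seq (l e.1, l e.2) | e <- U].

(** Once every edge is contracted, the GOE side merely counts labellings of the identified vertices,
    which is the count that [tree_bound] produces on the quotient graph. *)
Lemma spanning_tree_bound P Q : graph_connected (P ++ Q) ->
  r%:R * \sum_(l : {ffun V -> 'I_n} | respects Q l) \prod_(e <- P) b (l e.1) (l e.2) ^+ 2
  <= n%:R * sg ^+ (2 * size P) * \sum_(l : {ffun V -> 'I_r} | respects Q l) 1.
Proof.
move=> cPQ; rewrite !sum_respects sumr_const.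
set P' := [seq (qcl Q e.1, qcl Q e.2) | e <- P].
have := @tree_bound R (qclass Q) n r (fun i j => b i j ^+ 2) (sg ^+ 2)
  (sqr_ge0 _) (fun i j => sqr_ge0 _) (fun i j => congr1 (fun x => x ^+ 2) (b_sym i j))
  b_le b_sum P' (qcl Q v0) (connected_quotient cPQ).
rewrite exprM -mulrA card_ffun card_ord size_map natrX; apply: le_trans.
rewrite ler_wpM2l// ler_sum// => l _.
  rewrite /weight big_map [leRHS](eq_bigl xpredT) => [|e]; last by rewrite /inside !inE.
by under eq_bigr do rewrite !ffunE.
Qed.

Lemma selsum_map (X Y : Type) (M : nmodType) (f : X -> Y) s (F : Y -> seq Y -> M) :
  selsum (map f s) F = selsum s (fun x t => F (f x) (map f t)).
Proof. by elim: s F => [|x s IH] F //=; rewrite IH. Qed.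

(* Induction on the word with Wick's formula: [P] lists the edges already
   contracted, [Q] the vertex identifications forced by the contractions, and [U]
   the edges that remain. *)
Lemma wick_comparison P Q U : graph_connected (P ++ Q ++ U) ->
  r%:R * \sum_(l : {ffun V -> 'I_n} | respects Q l)
    (\prod_(e <- P) b (l e.1) (l e.2) ^+ 2) * gword b (lword l U)
  <= n%:R * sg ^+ (2 * size P + size U) *
    \sum_(l : {ffun V -> 'I_r} | respects Q l)
      gword (const_mx 1 : 'M[R]_r) (lword l U).
Proof.
have [m] := ubnP (size U); elim: m P Q U => // m IH P Q [|e U] /= lt_m cPQU.
  rewrite cats0 in cPQU; rewrite addn0 /=; under eq_bigr do rewrite gword_nil mulr1.
  under [X in _ <= _ * X]eq_bigr do rewrite gword_nil.
  exact: spanning_tree_bound.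
(* The two ways of gluing [f] onto [e], one for each indicator of [ecov]. *)
pose Q1 (f : V * V) := [:: (e.1, f.1), (e.2, f.2) & Q].
pose Q2 (f : V * V) := [:: (e.1, f.2), (e.2, f.1) & Q].
have expand k (B : 'M[R]_k) (B_sym : forall i j, B i j = B j i) :
    \sum_(l : {ffun V -> 'I_k} | respects Q l)
      (\prod_(e <- P) B (l e.1) (l e.2) ^+ 2) * gword B (lword l (e :: U)) =
    selsum U (fun f t =>
      (\sum_(l : {ffun V -> 'I_k} | respects (Q1 f) l)
        (\prod_(e <- e :: P) B (l e.1) (l e.2) ^+ 2) * gword B (lword l t))
    + (\sum_(l : {ffun V -> 'I_k} | respects (Q2 f) l)
        (\prod_(e <- e :: P) B (l e.1) (l e.2) ^+ 2) * gword B (lword l t))).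
  under eq_bigr do rewrite /= (gword_cons B_sym) selsum_map mulr_selsumr.
  rewrite big_mkcond/=.
  transitivity (\sum_(l : {ffun V -> 'I_k}) selsum U (fun f t =>
      (if respects (Q1 f) l then
         (\prod_(e <- e :: P) B (l e.1) (l e.2) ^+ 2) * gword B (lword l t) else 0)
    + (if respects (Q2 f) l then
         (\prod_(e <- e :: P) B (l e.1) (l e.2) ^+ 2) * gword B (lword l t) else 0))).
    apply: eq_bigr => l _; rewrite /respects /Q1 /Q2 /=; case: ifP => lQ; last first.
      rewrite (eq_selsum (G := fun _ _ => 0)) => [|s1 f s2 _]; last by rewrite !andbF addr0.
      by elim: U {IH lt_m cPQU} => //= f U <-; rewrite addr0.
    apply: eq_selsum => s1 f s2 _; rewrite !andbT big_cons /ecov /eswap /= !xpair_eqE.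
    case: eqP => _; case: eqP => _; case: eqP => _; case: eqP => _ /=; ring.
  rewrite -selsum_sum; apply: eq_selsum => s1 f s2 _.
  by rewrite big_split/= -!big_mkcond.
rewrite expand//.
have -> : \sum_(l : {ffun V -> 'I_r} | respects Q l)
    gword (const_mx 1 : 'M[R]_r) (lword l (e :: U)) =
  selsum U (fun f t =>
    \sum_(l : {ffun V -> 'I_r} | respects (Q1 f) l) gword (const_mx 1 : 'M[R]_r) (lword l t)
  + \sum_(l : {ffun V -> 'I_r} | respects (Q2 f) l) gword (const_mx 1 : 'M[R]_r) (lword l t)).
  have one (E : seq (V * V)) (l : {ffun V -> 'I_r}) :
    \prod_(e <- E) (const_mx 1 : 'M[R]_r) (l e.1) (l e.2) ^+ 2 = 1.
    by rewrite big1// => x _; rewrite mxE expr1n.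
  have := expand r (const_mx 1) (fun i j => ltac:(by rewrite !mxE)).
  under eq_bigr do rewrite one mul1r.
  move=> ->; apply: eq_selsum => s1 f s2 _.
  by congr (_ + _); apply: eq_bigr => l _; rewrite one mul1r.
rewrite !mulr_selsumr; apply: ler_selsum => s1 f s2 U_s; rewrite !mulrDr.
have lt_s : (size (s1 ++ s2) < m)%N.
  by move: lt_m; rewrite U_s !size_cat /=; lia.
have eq_e : (2 * size P + (size U).+1 = 2 * size (e :: P) + size (s1 ++ s2))%N.
  by rewrite U_s !size_cat /=; lia.
(* The partner [f] leaves the graph, but its ends stay joined through [e] and the two new
   identifications. *)
have conn (Q' : seq (V * V)) :
    {subset Q <= Q'} ->
    connect (symrel ((e :: P) ++ Q' ++ s1 ++ s2)) f.1 f.2 ->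
    graph_connected ((e :: P) ++ Q' ++ s1 ++ s2).
  move=> QQ' cf; apply: sub_connected cPQU => x; rewrite !mem_cat inE U_s mem_cat inE.
  move=> /or3P[xP|xQ|/or3P[xe|xs1|/orP[/eqP->//|xs2]]]; apply: connect1_symrel;
    rewrite !mem_cat inE ?xP ?xe ?xs1 ?xs2 ?orbT//.
  by rewrite (QQ' _ xQ) ?orbT.
have edge1 (E : seq (V * V)) u v : (u, v) \in E -> connect (symrel E) u v.
  exact: connect1_symrel.
have sub (x y : V * V) : {subset Q <= [:: x, y & Q]}.
  by move=> z zQ; rewrite !inE zQ !orbT.
rewrite eq_e; apply: lerD; apply: IH => //; (apply: conn; first exact: sub).
  apply: (@connect_trans _ _ e.1).
    by rewrite connect_symrelC; apply: edge1; rewrite !(mem_cat, inE) eqxx ?orbT.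
  apply: (@connect_trans _ _ e.2).
    by apply: edge1; rewrite !(mem_cat, inE) -surjective_pairing eqxx.
  by apply: edge1; rewrite !(mem_cat, inE) eqxx ?orbT.
apply: (@connect_trans _ _ e.2).
  by rewrite connect_symrelC; apply: edge1; rewrite !(mem_cat, inE) eqxx ?orbT.
apply: (@connect_trans _ _ e.1).
  rewrite connect_symrelC.
  by apply: edge1; rewrite !(mem_cat, inE) -surjective_pairing eqxx.
by apply: edge1; rewrite !(mem_cat, inE) eqxx ?orbT.
Qed.

End Comparison.

Section WalkLabels.
Variables (R : realFieldType) (n : nat).

Lemma inordS N k : (k <= N)%N -> inord k.+1 = lift ord0 (inord k : 'I_N.+1) :> 'I_N.+2.
Proof. by move=> le_kN; apply: val_inj; rewrite /= /bump !inordK. Qed.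

Definition path_edges N : seq ('I_N.+1 * 'I_N.+1) :=
  [seq (inord k, inord k.+1) | k <- iota 0 N].

(** Without shift, a walk is a labelling of the vertices of one fixed path; the same graph then
    serves both dimensions [n] and [r]. *)
Lemma walk_labels N i j F : wsum (walk (0 : R) N i j) F =
  \sum_(l : {ffun 'I_N.+1 -> 'I_n} | (l ord0 == i) && (l ord_max == j))
    F (lword l (path_edges N)).
Proof.
elim: N i F => [|N IH] i F.
  rewrite walks0; have [->|ij] := eqVneq i j; last first.
    rewrite mul0r big_pred0// => l; rewrite (_ : ord_max = ord0); last exact: val_inj.
    by apply: contra_neqF ij => /andP[/eqP-> /eqP->].
  rewrite mul1r (big_pred1 [ffun=> j]) => [|l]; first by [].
  rewrite (_ : ord_max = ord0); last exact: val_inj.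
  rewrite andbb /=; apply/eqP/eqP => [<-|->]; last by rewrite ffunE.
  by apply/ffunP => k; rewrite ffunE ord1.
rewrite walksS mul0r add0r.
under eq_bigr do rewrite IH.
pose h (l : {ffun 'I_N.+1 -> 'I_n}) : {ffun 'I_N.+2 -> 'I_n} :=
  [ffun k => if unlift ord0 k is Some k' then l k' else i].
pose h' (l : {ffun 'I_N.+2 -> 'I_n}) : {ffun 'I_N.+1 -> 'I_n} :=
  [ffun k => l (lift ord0 k)].
have h0 l : h l ord0 = i by rewrite ffunE unlift_none.
have hS l k : h l (lift ord0 k) = l k by rewrite ffunE liftK.
rewrite [RHS](reindex_onto h h') => [|l /andP[/eqP l0 _]]; last first.
  apply/ffunP => k; rewrite !ffunE; case: unliftP => [k' ->|->]; last by rewrite l0.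
  by rewrite ffunE.
rewrite (exchange_big_dep (fun l : {ffun 'I_N.+1 -> 'I_n} => l ord_max == j)) => [|x l _ /andP[]//].
rewrite /=; apply: eq_big => [l|l /eqP lj].
  rewrite h0 eqxx /= (_ : ord_max = lift ord0 ord_max); last exact: val_inj.
  by rewrite hS andb_idr// => _; apply/eqP/ffunP => k; rewrite ffunE hS.
rewrite (big_pred1 (l ord0)) => [|x]; last by rewrite lj eqxx andbT eq_sym.
congr F; rewrite /lword /path_edges /= (iotaDl 1 0) -!map_comp.
have e0 : inord 0 = ord0 :> 'I_N.+2 by apply: val_inj; rewrite /= inordK.
congr cons.
  rewrite e0 h0 inordS// hS; congr (i, l _).
  by apply: val_inj; rewrite /= inordK.
apply/eq_in_map => k; rewrite mem_iota add0n => /andP[_ ltkN] /=.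
by rewrite add1n !inordS ?hS// ltnW.
Qed.

Lemma walk_loops_labels N F : \sum_(i < n) wsum (walk (0 : R) N i i) F =
  \sum_(l : {ffun 'I_N.+1 -> 'I_n} | respects [:: (ord0, ord_max)] l)
    F (lword l (path_edges N)).
Proof.
under eq_bigr do rewrite walk_labels.
rewrite (exchange_big_dep (fun l : {ffun 'I_N.+1 -> 'I_n} => l ord0 == l ord_max)) /=.
  apply: eq_big => [l|l /eqP ll]; first by rewrite /respects /= andbT.
  by rewrite (big_pred1 (l ord0)) => [|i]; rewrite //= -ll andbb eq_sym.
by move=> i l _ /andP[/eqP-> /eqP->].
Qed.

Lemma connected_path N (Q : seq ('I_N.+1 * 'I_N.+1)) : graph_connected (Q ++ path_edges N).
Proof.
have conn0 u : connect (symrel (Q ++ path_edges N)) ord0 u.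
  rewrite -(inord_val u); have := ltn_ord u.
  elim: (val u) => [|k IH] ltkN.
    by rewrite (_ : inord 0 = ord0)//; apply: val_inj; rewrite /= inordK.
  apply: connect_trans (IH (ltnW ltkN)) _.
  apply: (@connect1_symrel _ _ (inord k, inord k.+1)).
  by rewrite mem_cat; apply/orP; right; apply/mapP; exists k; rewrite ?mem_iota.
by move=> u v; apply: connect_trans (conn0 v); rewrite connect_symrelC.
Qed.

End WalkLabels.

Lemma walk_comparison (R : realFieldType) (n r N : nat) (b : 'M[R]_n) (sg : R) :
  0 <= sg -> (forall i j, b i j = b j i) -> (forall i j, b i j ^+ 2 <= sg ^+ 2) ->
  (forall i, \sum_j b i j ^+ 2 <= r%:R * sg ^+ 2) ->
  r%:R * \sum_i wsum (walk 0 N i i) (gword b) <=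
  n%:R * sg ^+ N * goe_trace r 0 [:: N].
Proof.
move=> sg0 b_sym b_le b_sum; rewrite goe_trace1E !walk_loops_labels.
(* Nothing is contracted yet; identifying the two ends closes the path. *)
have := wick_comparison ord0 sg0 b_sym b_le b_sum (P := [::])
  (connected_path [:: (ord0, ord_max)]).
move=> /(_ N); rewrite muln0 add0n size_map size_iota.
by under eq_bigr do rewrite big_nil mul1r.
Qed.

(** * Moments of products of independent variables *)

Section ImageDensity.
Context (d d' : measure_display) (T : measurableType d) (T' : measurableType d').
Context (R : realType) (mu : {measure set T -> \bar R}) (nu : {measure set T' -> \bar R}).
Variables (Y : T -> T') (g : T -> R).
Hypothesis mY : measurable_fun setT Y.
Hypothesis mg : measurable_fun setT g.
Hypothesis g0 : forall w, 0 <= g w.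
Hypothesis nuE : forall A, measurable A ->
  (\int[mu]_w (\1_A (Y w) * g w)%:E = nu A)%E.

Let image_density_nnsfun (h : {nnsfun T' >-> R}) :
  (\int[mu]_w (h (Y w) * g w)%:E = \int[nu]_y (h y)%:E)%E.
Proof.
pose s : seq R := finmap.enum_fset (fset_set (range h)).
pose I y w : R := \1_(h @^-1` [set y]) (Y w).
have mI y : measurable_fun setT (I y).
  by apply: measurableT_comp => //; exact: measurable_indic.
have I0 y w : 0 <= I y w by rewrite /I numfun.indicE ler0n.
(* The absolute value changes nothing on the range of [h] and makes every coefficient visibly
   nonnegative. *)
have hE w : h (Y w) = \sum_(y <- s) `|y| * I y w.
  rewrite fimfunE fsbig_finite//=; apply: eq_big_seq => y.
  by rewrite in_fset_set// inE => -[x _ <-]; rewrite ger0_norm//; exact: fun_ge0.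
transitivity (\sum_(y <- s) `|y|%:E * \int[mu]_w (I y w * g w)%:E)%E.
  under eq_integral do rewrite hE mulr_suml -sumEFin.
  rewrite ge0_integral_sum//=.
  - apply: eq_bigr => y _; under eq_integral do rewrite -mulrA EFinM.
    rewrite ge0_integralZl_EFin//=.
    + by move=> x _; rewrite lee_fin mulr_ge0.
    + by apply/measurable_EFinP/measurable_funM => //; exact: mI.
  - move=> i; apply/measurable_EFinP/measurable_funM => //.
    by apply: measurable_funM => //; exact: mI.
  - by move=> i x _; rewrite lee_fin !mulr_ge0//; exact: I0.
transitivity (\sum_(y <- s) `|y|%:E * \int[nu]_z (\1_(h @^-1` [set y]) z)%:E)%E.
  by apply: eq_bigr => y _; rewrite nuE// integral_indic// setIT.
have h'E z : h z = \sum_(y <- s) `|y| * \1_(h @^-1` [set y]) z.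
  rewrite fimfunE fsbig_finite//=; apply: eq_big_seq => y.
  by rewrite in_fset_set// inE => -[x _ <-]; rewrite ger0_norm//; exact: fun_ge0.
apply/esym; under eq_integral do rewrite h'E -sumEFin.
rewrite ge0_integral_sum//=.
- apply: eq_bigr => i _; under eq_integral do rewrite EFinM.
  rewrite ge0_integralZl_EFin//=.
  by apply/measurable_EFinP; exact: measurable_indic.
- by move=> i; apply/measurable_EFinP/measurable_funM => //; exact: measurable_indic.
Qed.

(** Monotone approximation by simple functions. It serves three times: with [g] a product of
    independent factors, with [g] the normal density, and with [Y] the opposite of a symmetric
    variable. *)
Lemma image_density (f : T' -> R) : measurable_fun setT f -> (forall x, 0 <= f x) ->
  (\int[mu]_w (f (Y w) * g w)%:E = \int[nu]_y (f y)%:E)%E.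
Proof.
move=> mf f0.
have mEf : measurable_fun setT (EFin \o f) by exact/measurable_EFinP.
pose f_ := nnsfun_approx measurableT mEf.
have cvf x : (f_ n x)%:E @[n --> \oo] --> (f x)%:E.
  by apply: (@cvg_nnsfun_approx _ _ _ _ measurableT _ mEf (fun x _ => f0 x) x).
have mfY n : measurable_fun setT (fun w => f_ n (Y w)).
  by apply: measurableT_comp.
have cvnu : (\int[nu]_y (f_ n y)%:E @[n --> \oo] --> \int[nu]_y (f y)%:E)%E.
  rewrite [X in _ --> X](_ : _ = \int[nu]_y limn (fun n => (f_ n y)%:E))%E.
    apply: cvg_monotone_convergence => //.
    - by move=> n; exact/measurable_EFinP.
    - by move=> n w _; rewrite lee_fin.
    - by move=> w _ a b ab; rewrite lee_fin; exact/lefP/nd_nnsfun_approx.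
  by apply: eq_integral => w _; apply/esym/cvg_lim.
have cvmu : (\int[mu]_w (f_ n (Y w) * g w)%:E @[n --> \oo] --> \int[mu]_w (f (Y w) * g w)%:E)%E.
  rewrite [X in _ --> X](_ : _ = \int[mu]_w limn (fun n => (f_ n (Y w) * g w)%:E))%E.
    apply: cvg_monotone_convergence => //.
    - by move=> n; exact/measurable_EFinP/measurable_funM.
    - by move=> n w _; rewrite lee_fin mulr_ge0.
    - by move=> w _ a b ab; rewrite lee_fin ler_wpM2r//; exact/lefP/nd_nnsfun_approx.
  apply: eq_integral => w _; apply/esym/cvg_lim => //.
  under eq_fun do rewrite EFinM muleC.
  by rewrite EFinM muleC; apply: cvgeZl.
rewrite -(cvg_lim _ cvnu)// -(cvg_lim _ cvmu)//.
by congr (lim (_ @ \oo)); apply/funext => n; exact: image_density_nnsfun.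
Qed.
End ImageDensity.

Lemma indep_integral_mul (d : measure_display) (T : measurableType d) (R : realType)
    (P : probability T R) (Y : {RV P >-> R}) (g : T -> R) (c : R) :
  measurable_fun setT g -> (forall w, 0 <= g w) -> 0 <= c ->
  (forall A, measurable A ->
    (\int[P]_w (\1_A (Y w) * g w)%:E = c%:E * P (Y @^-1` A))%E) ->
  forall f : R -> R, measurable_fun setT f -> (forall x, 0 <= f x) ->
  (\int[P]_w (f (Y w) * g w)%:E = c%:E * \int[P]_w (f (Y w))%:E)%E.
Proof.
move=> mg g0 c0 cE f mf f0.
rewrite (@image_density _ _ _ _ _ _ (mscale (NngNum c0) (distribution P Y)))//.
rewrite ge0_integral_mscale//; last first.
- by move=> x _; rewrite lee_fin.
- exact/measurable_EFinP.
by rewrite ge0_integral_distribution//; exact/measurable_EFinP.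
Qed.

Section IndependenceProduct.
Context (d : measure_display) (T : measurableType d) (R : realType) (P : probability T R).
Variables (I : finType) (D : {set I}) (X : I -> {RV P >-> R}).
Hypothesis indepX : independent_RVs P D X.
Implicit Types (f : I -> R -> R) (s : seq I).
Local Notation E F := (Rintegral P setT F).

Let measurable_comp_RV f i : measurable_fun setT (f i) ->
  measurable_fun setT (fun w => f i (X i w)).
Proof. by move=> mf; apply: measurableT_comp. Qed.

Lemma measurable_prod_RV f s : (forall i, measurable_fun setT (f i)) ->
  measurable_fun setT (fun w => \prod_(i <- s) f i (X i w)).
Proof. by move=> mf; apply: measurable_prod => i _; exact: measurable_comp_RV. Qed.

Lemma indep_prod_indic (A : I -> set R) s : (forall i, measurable (A i)) ->
  uniq s -> {subset s <= D} ->
  (\int[P]_w (\prod_(i <- s) \1_(A i) (X i w))%:E = \prod_(i <- s) P (X i @^-1` A i))%E.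
Proof.
move=> mA us sD; pose J := [set i in s]%SET.
have JD : J \subset D by apply/fintype.subsetP => i; rewrite inE; exact: sD.
have mXA i : measurable (X i @^-1` A i).
  by rewrite -[X in measurable X]setTI; exact: (measurable_funP (X i)).
have := indepX JD (fun i _ => mA i).
rewrite [X in _ = X -> _](_ : _ = \prod_(i <- s) P (X i @^-1` A i))%E; last first.
  by rewrite big_uniq//=; apply: eq_bigl => i; rewrite inE.
move=> <-; set B := bigcap _ _.
rewrite -[in RHS](setIT B) -integral_indic//; last exact: fin_bigcap_measurable.
apply: eq_integral => w _; congr EFin; rewrite numfun.indicE.
have [wB|wB] := boolP (w \in B).
  rewrite big1_seq// => i /andP[_ si]; rewrite numfun.indicE mem_set//.
  by move: wB; rewrite inE => /(_ i); apply; rewrite /= inE.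
have [i si wi] : exists2 i, i \in s & ~ A i (X i w).
  apply: contraNP wB => H; rewrite inE => i /=; rewrite inE => si.
  by apply: contrapT => wi; apply: H; exists i.
by rewrite (big_rem i)//= numfun.indicE memNset// mul0r.
Qed.

(* The indicators are replaced by the functions [f i] one factor at a time. *)
Lemma indep_prod_ge0 f (A : I -> set R) s1 s2 :
  (forall i, measurable_fun setT (f i)) -> (forall i x, 0 <= f i x) ->
  (forall i, P.-integrable setT (fun w => (f i (X i w))%:E)) ->
  (forall i, measurable (A i)) ->
  uniq (s1 ++ s2) -> {subset s1 ++ s2 <= D} ->
  (\int[P]_w (\prod_(i <- s1) f i (X i w) * \prod_(i <- s2) \1_(A i) (X i w))%:E =
  (\prod_(i <- s1) E (fun w => f i (X i w)) * \prod_(i <- s2) fine (P (X i @^-1` A i)))%:E)%E.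
Proof.
move=> mf f0 intf; elim: s1 s2 A => [|i s1 IH] s2 A mA us sD.
  under eq_integral do rewrite big_nil mul1r.
  rewrite indep_prod_indic// big_nil mul1r -prodEFin; apply: eq_bigr => i _.
  by rewrite fineK// fin_num_measure// -[X in measurable X]setTI; exact: (measurable_funP (X i)).
under eq_integral do rewrite big_cons -mulrA.
set c := \prod_(i <- s1) E (fun w => f i (X i w)) *
  \prod_(i <- s2) fine (P (X i @^-1` A i)).
rewrite (@indep_integral_mul _ _ _ _ (X i) _ c) => //.
- rewrite big_cons -mulrA -/c [in RHS]mulrC [in RHS]EFinM; congr (_ * _)%E.
  by rewrite /Rintegral fineK//; apply: integrable_fin_num.
- apply: measurable_funM; first exact: measurable_prod_RV.
  apply: measurable_prod => j _.
  have mIA : measurable_fun setT (\1_(A j) : R -> R) by exact: measurable_indic.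
  by apply: (measurableT_comp mIA).
- by move=> w; rewrite mulr_ge0// prodr_ge0// => j _; rewrite numfun.indicE ler0n.
- rewrite /c mulr_ge0// prodr_ge0// => j _; first by apply: Rintegral_ge0.
  by rewrite fine_ge0.
(* The test set [B] turns the factor [i] into an indicator, which moves it to the second list. *)
move=> B mB; pose A' j := if j == i then B else A j.
have mA' j : measurable (A' j) by rewrite /A'; case: ifP.
have iN : i \notin s1 ++ s2 by case/andP: us.
have A'E j : j \in s2 -> A' j = A j.
  by move=> js; rewrite /A' ifF//; apply: contraNF iN => /eqP <-; rewrite mem_cat js orbT.
have pe : perm_eq (s1 ++ i :: s2) (i :: s1 ++ s2) by rewrite -cat1s perm_catCA.
have A'i : A' i = B by rewrite /A' eqxx.
have us' : uniq (s1 ++ i :: s2) by rewrite (perm_uniq pe).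
have sD' : {subset s1 ++ i :: s2 <= D} by move=> j; rewrite (perm_mem pe); exact: sD.
have := IH (i :: s2) A' mA' us' sD'.
under eq_integral do rewrite big_cons A'i.
rewrite [X in _ = X -> _](_ : _ = c%:E * P (X i @^-1` B))%E; last first.
  rewrite big_cons A'i mulrCA mulrC EFinM fineK; last first.
    by rewrite fin_num_measure// -[X in measurable X]setTI; exact: (measurable_funP (X i)).
  by congr ((_ * _)%:E * _)%E; apply: eq_big_seq => j js; rewrite A'E.
move=> <-; apply: eq_integral => w _; congr EFin; rewrite mulrCA.
by congr (_ * (_ * _)); apply: eq_big_seq => j js; rewrite A'E.
Qed.

Lemma indep_prod_integrable f s :
  (forall i, P.-integrable setT (fun w => (f i (X i w))%:E)) ->
  (forall i, measurable_fun setT (f i)) -> uniq s -> {subset s <= D} ->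
  P.-integrable setT (fun w => (\prod_(i <- s) f i (X i w))%:E).
Proof.
move=> intf mf us sD; apply/integrableP; split.
  by apply/measurable_EFinP; exact: measurable_prod_RV.
have := @indep_prod_ge0 (fun i x => `|f i x|) (fun=> setT) s [::] _ _ _ _ _ _.
rewrite cats0; under eq_integral do rewrite big_nil mulr1 -normr_prod.
rewrite /= => ->//; first exact: ltry.
- by move=> i; apply: measurableT_comp.
- by move=> i; exact: integrable_abse (intf i).
Qed.

(* The factors are split into positive and negative parts one at a time. *)
Lemma indep_prod f s :
  (forall i, P.-integrable setT (fun w => (f i (X i w))%:E)) ->
  (forall i, measurable_fun setT (f i)) -> uniq s -> {subset s <= D} ->
  E (fun w => \prod_(i <- s) f i (X i w)) = \prod_(i <- s) E (fun w => f i (X i w)).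
Proof.
move=> intf mf us sD.
(* The factors over [s1] have arbitrary sign, those over [s2] are already nonnegative; [g] is
   generalized because splitting a factor changes the family. *)
suff claim s1 s2 g : (forall i, P.-integrable setT (fun w => (g i (X i w))%:E)) ->
    (forall i, measurable_fun setT (g i)) ->
    uniq (s1 ++ s2) -> {subset s1 ++ s2 <= D} -> {in s2, forall i x, 0 <= g i x} ->
    E (fun w => \prod_(i <- s1 ++ s2) g i (X i w)) =
    \prod_(i <- s1 ++ s2) E (fun w => g i (X i w)).
  by have := claim s [::] f intf mf; rewrite cats0; apply.
elim: s1 s2 g {intf mf us sD} => [|i s1 IH] s2 g intg mg us sD g0.
  have := @indep_prod_ge0 (fun i x => `|g i x|) (fun=> setT) s2 [::] _ _ _ _ _ _.
  rewrite cats0 big_nil mulr1 /= => H; rewrite /Rintegral.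
  have -> : (\int[P]_w (\prod_(i <- s2) g i (X i w))%:E =
      \int[P]_w (\prod_(i <- s2) `|g i (X i w)| * \prod_(i <- [::]) \1_(setT : set R) (X i w))%:E)%E.
    apply: eq_integral => w _; rewrite big_nil mulr1; congr EFin.
    by apply: eq_big_seq => j js; rewrite ger0_norm// g0.
  rewrite H//=.
  - apply: eq_big_seq => j js; congr fine; apply: eq_integral => w _.
    by rewrite ger0_norm// g0.
  - by move=> j; apply: measurableT_comp.
  - by move=> j; exact: integrable_abse (intg j).
have pe : perm_eq (s1 ++ i :: s2) (i :: s1 ++ s2) by rewrite -cat1s perm_catCA.
(* The factor [i] becomes its positive part for [sgn = 1] and its negative part for [sgn = -1]. *)
pose gp (sgn : R) j x := if j == i then Num.max (sgn * g i x) 0 else g j x.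
have gpE sgn j : j \in s1 ++ s2 -> gp sgn j = g j.
  move=> js; apply/funext => x; rewrite /gp ifF//; apply/eqP => ji.
  by move: us; rewrite /= -ji js.
have mgp sgn j : measurable_fun setT (gp sgn j).
  rewrite /gp; case: eqP => _ //.
  by apply: measurable_maxr => //; apply: measurable_funM.
have intgp sgn j : P.-integrable setT (fun w => (gp sgn j (X j w))%:E).
  rewrite /gp; case: eqP => [->|_] //.
  apply: (@le_integrable _ _ _ _ _ measurableT _ (fun w => sgn%:E * (g i (X i w))%:E)%E).
  - apply/measurable_EFinP.
    have mm : measurable_fun setT (fun x => Num.max (sgn * g i x) 0).
      by apply: measurable_maxr => //; apply: measurable_funM.
    by apply: (measurableT_comp mm).
  - move=> w _ /=; rewrite lee_fin maxEle; case: ifP => //.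
    by rewrite normr0.
  - exact: integrableZl.
have claim sgn : E (fun w => gp sgn i (X i w) * \prod_(j <- s1 ++ s2) g j (X j w)) =
    E (fun w => gp sgn i (X i w)) * \prod_(j <- s1 ++ s2) E (fun w => g j (X j w)).
  have := IH (i :: s2) (gp sgn) (intgp sgn) (mgp sgn) _ _ _.
  rewrite (perm_uniq pe) (perm_big _ pe)/= big_cons => H.
  rewrite (_ : (fun w => _) = (fun w => \prod_(j <- s1 ++ i :: s2) gp sgn j (X j w))); last first.
    apply/funext => w; rewrite (perm_big _ pe)/= big_cons; congr (_ * _).
    by apply: eq_big_seq => j js; rewrite gpE.
  rewrite H//; first by congr (_ * _); apply: eq_big_seq => j js; rewrite gpE.
  - by move=> j; rewrite (perm_mem pe); exact: sD.
  - move=> j; rewrite inE => /predU1P[->|js] x.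
      by rewrite /gp eqxx le_max lexx orbT.
    by rewrite gpE ?g0// mem_cat js orbT.
have gE x : g i x = gp 1 i x - gp (-1) i x.
  rewrite /gp eqxx mul1r mulN1r !maxEle oppr_le0.
  by case: (leP (g i x) 0) => gi; case: leP => gi'; lra.
set G := fun w => \prod_(j <- s1 ++ s2) g j (X j w) in claim *.
have intGp sgn : P.-integrable setT (fun w => (gp sgn i (X i w) * G w)%:E).
  have := @indep_prod_integrable (gp sgn) (i :: s1 ++ s2) (intgp sgn) (mgp sgn) us sD.
  apply: eq_integrable => // w _; congr EFin; rewrite big_cons; congr (_ * _).
  by apply: eq_big_seq => j js; rewrite gpE.
rewrite [in RHS]/= big_cons.
have -> : E (fun w => g i (X i w)) = E (fun w => gp 1 i (X i w)) - E (fun w => gp (-1) i (X i w)).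
  rewrite -RintegralB//; last 2 first.
    exact: intgp.
    exact: intgp.
  by apply: eq_Rintegral => w _; rewrite gE.
rewrite mulrBl -!claim -RintegralB//; last 2 first.
  exact: intGp.
  exact: intGp.
by apply: eq_Rintegral => w _; rewrite /= big_cons gE mulrBl.
Qed.

End IndependenceProduct.

(** * Moments of the standard normal law *)

Section NormalMoments.
Variable R : realType.
Local Notation mu := (@lebesgue_measure R).

Lemma normal_pdf01E (x : R) : normal_pdf (0 : R) 1 x = normal_peak 1 * expR (- x ^+ 2 / 2).
Proof.
rewrite normal_pdfE ?oner_neq0// /normal_fun subr0 expr1n.
by congr (_ * expR (_ / _)); rewrite mulr2n.
Qed.

Lemma is_derive_gaussian (x : R) :
  is_derive x (1 : R) (fun y : R => expR (- y ^+ 2 / 2)) (- x * expR (- x ^+ 2 / 2)).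
Proof.
have d2 : is_derive x (1:R) ((id : R -> R) ^+ 2) (2%:R * x *: (1:R)).
  by apply: is_derive_eq; rewrite expr1.
have dd : is_derive x (1:R) ((cst (- 2^-1) : R -> R) * (id : R -> R) ^+ 2) (- x).
  by apply: is_derive_eq; rewrite /GRing.scale /= mulr0 addr0; field.
have H := is_derive1_comp (is_derive_expR _) dd.
have E : expR \o ((cst (- 2^-1) : R -> R) * (id : R -> R) ^+ 2) = (fun y : R => expR (- y ^+ 2 / 2)).
  by apply/funext => y /=; congr expR; rewrite mulNr -mulrN mulrC.
rewrite E in H.
apply: (@is_derive_eq _ _ _ _ _ _ _ _ H).
rewrite mulrC; congr (_ * expR _).
by rewrite mulNr -mulrN mulrC.
Qed.

Lemma is_derive_gaussian_moment (k : nat) (x : R) :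
  is_derive x (1:R) (fun y : R => - (y ^+ k.+1 * expR (- y ^+ 2 / 2)))
    (x ^+ k.+2 * expR (- x ^+ 2 / 2) - k.+1%:R * x ^+ k * expR (- x ^+ 2 / 2)).
Proof.
have df := is_derive_gaussian x.
have dk : is_derive x (1:R) ((id : R -> R) ^+ k.+1) (k.+1%:R * x ^+ k *: (1:R)).
  exact: is_deriveX.
have H := is_deriveN (is_deriveM dk df).
have E : - ((id : R -> R) ^+ k.+1 * (fun y : R => expR (- y ^+ 2 / 2))) =
    (fun y : R => - (y ^+ k.+1 * expR (- y ^+ 2 / 2))).
  by apply/funext => y; rewrite -[LHS]/(- (((id : R -> R) ^+ k.+1) y * _)) exprfctE.
rewrite E in H.
apply: (@is_derive_eq _ _ _ _ _ _ _ _ H).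
rewrite /GRing.scale /= exprfctE.
rewrite !exprS; ring.
Qed.

Local Notation psi := (fun x : R => expR (- x ^+ 2 / 2)).

Lemma continuous_gaussian_moment k : continuous (fun x : R => x ^+ k * psi x).
Proof.
have cpsi : continuous psi.
  move=> x; apply/differentiable_continuous/derivable1_diffP.
  by have [] := is_derive_gaussian x.
by move=> x; apply: cvgM; [exact: exprn_continuous|exact: cpsi].
Qed.

Lemma integrable_gaussian_moment k (a b : R) :
  mu.-integrable `[a, b] (fun x => (x ^+ k * psi x)%:E).
Proof.
apply: continuous_compact_integrable; first exact: segment_compact.
exact/continuous_subspaceT/continuous_gaussian_moment.
Qed.

Definition trunc_moment k (M : R) : R := \int[mu]_(x in `[- M, M]) (x ^+ k * psi x).

(* For even exponents the boundary terms of the integration by parts on [-M, M]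
   have a favourable sign. *)
Lemma trunc_momentSS p (M : R) : 0 < M ->
  trunc_moment (2 * p).+2 M <= (2 * p).+1%:R * trunc_moment (2 * p) M.
Proof.
move=> M0; pose k := (2 * p)%N; rewrite -/k.
pose F := (fun y : R => - (y ^+ k.+1 * psi y)).
have dF x : is_derive x (1 : R) F (x ^+ k.+2 * psi x - k.+1%:R * x ^+ k * psi x).
  exact: is_derive_gaussian_moment.
have cF : continuous F.
  by move=> x; apply/differentiable_continuous/derivable1_diffP; have [] := dF x.
have MM : - M < M by lra.
have cG : continuous (fun x : R => x ^+ k.+2 * psi x - k.+1%:R * x ^+ k * psi x).
  under eq_fun do rewrite -mulrA.
  move=> x; apply: cvgB; first exact: continuous_gaussian_moment.
  by apply: cvgM; [exact: cvg_cst|exact: continuous_gaussian_moment].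
have ftc : (\int[mu]_(x in `[(- M)%R, M]) (x ^+ k.+2 * psi x - k.+1%:R * x ^+ k * psi x)%:E
    = (F M)%:E - (F (- M))%:E)%E.
  apply: continuous_FTC2 => //.
  - exact: continuous_subspaceT.
  - split.
    + by move=> x _; have [] := dF x.
    + by apply: cvg_at_right_filter; exact: cF.
    + by apply: cvg_at_left_filter; exact: cF.
  - by move=> x _; rewrite derive1E; apply: derive_val.
rewrite -subr_ge0 /trunc_moment -RintegralZl//; last exact: integrable_gaussian_moment.
rewrite -RintegralB//; last 2 first.
- exact: (integrableZl _ _ (integrable_gaussian_moment _ _ _)).
- exact: integrable_gaussian_moment.
rewrite [leRHS](_ : _ = - \int[mu]_(x in `[- M, M])
    (x ^+ k.+2 * psi x - k.+1%:R * x ^+ k * psi x)); last first.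
  rewrite -[in RHS]mulN1r -RintegralZl//.
    by apply: eq_Rintegral => x _; ring.
  apply: continuous_compact_integrable; first exact: segment_compact.
  exact: continuous_subspaceT.
rewrite /Rintegral ftc /= /F sqrrN.
have -> : (- M) ^+ k.+1 = - M ^+ k.+1.
  by rewrite exprNn -signr_odd /= /k oddM /= expr1 mulN1r.
have : 0 <= M ^+ k.+1 * expR (- M ^+ 2 / 2).
  by rewrite mulr_ge0 ?expR_ge0// exprn_ge0// ltW.
by rewrite mulNr; lra.
Qed.

Lemma trunc_moment_le p (M : R) : 0 < M ->
  normal_peak 1 * trunc_moment (2 * p) M <= gmom 1 (2 * p).
Proof.
move=> M0; elim: p => [|p IH].
  rewrite muln0 /trunc_moment -RintegralZl//; last exact: integrable_gaussian_moment.
  rewrite -lee_fin /Rintegral fineK; last first.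
    apply: integrable_fin_num => //.
    exact: (integrableZl _ _ (integrable_gaussian_moment 0 _ _)).
  rewrite (_ : (gmom 1 0)%:E = \int[mu]_x (normal_pdf 0 1 x)%:E)%E; last by rewrite integral_normal_pdf.
  apply: (@le_trans _ _ (\int[mu]_(x in `[(- M)%R, M]) (normal_pdf 0 1 x)%:E)%E).
    rewrite le_eqVlt; apply/orP; left; apply/eqP; apply: eq_integral => x _.
    by rewrite normal_pdf01E expr0 mul1r.
  apply: ge0_subset_integral => //.
    by apply/measurable_EFinP; exact: measurable_normal_pdf.
  by move=> x _; rewrite lee_fin normal_pdf_ge0.
rewrite (_ : (2 * p.+1 = (2 * p).+2)%N); last by lia.
rewrite gmomS mul1r succnK.
apply: le_trans (ler_wpM2l (normal_peak_ge0 _) (trunc_momentSS p M0)) _.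
by rewrite mulrCA ler_wpM2l.
Qed.

(** An upper bound is enough for the comparison, so it passes from the truncated moments to their
    monotone limit. *)
Lemma normal_moment_le p :
  ('E_(normal_prob 0 1)[fun x : R => (x ^+ (2 * p))%R] <= (gmom 1 (2 * p))%:E)%E.
Proof.
have sq_ge0 (x : R) : 0 <= x ^+ (2 * p) by rewrite exprM exprn_ge0// sqr_ge0.
have mpow : measurable_fun setT (fun x : R => x ^+ (2 * p)) by exact: measurable_funX.
rewrite unlock -(@image_density _ _ _ _ _ mu (normal_prob (0:R) 1) (@id R)
  (normal_pdf 0 1) _ _ _ _ (fun x => x ^+ (2 * p)))//=; last first.
- move=> A mA; rewrite /normal_prob [RHS]integral_mkcond.
  apply: eq_integral => x _; rewrite restrict_EFin /patch; congr EFin.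
  by rewrite numfun.indicE; case: (x \in A); rewrite ?mul1r ?mul0r.
- exact: normal_pdf_ge0.
- exact: measurable_normal_pdf.
pose F (n : nat) : set R := [set` `[- (n.+1%:R : R), n.+1%:R]].
have FT : \bigcup_n F n = setT.
  apply/seteqP; split => // x _; exists (Num.truncn `|x|) => //.
  by rewrite /F /= in_itv /= -ler_norml ltW// truncnS_gt.
pose f x : \bar R := (x ^+ (2 * p) * normal_pdf 0 1 x)%:E.
have ndF : nondecreasing_seq F.
  move=> a b ab; apply/subsetPset => x; rewrite /F /= !in_itv /= => /andP[ax xa].
  have ab' : a.+1%:R <= b.+1%:R :> R by rewrite ler_nat ltnS.
  by apply/andP; split; lra.
have mF i : measurable (F i) by exact: measurable_itv.
have mf i : measurable_fun (F i) f.
  apply/measurable_EFinP; apply: measurable_funTS.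
  by apply: measurable_funM => //; exact: measurable_normal_pdf.
have f0 i x : F i x -> (0 <= f x)%E.
  by move=> _; rewrite lee_fin mulr_ge0// normal_pdf_ge0.
have cv := @ge0_nondecreasing_set_cvg_integral _ (measurableTypeR R) R F f mu ndF mF mf f0.
rewrite -FT -(cvg_lim _ cv)//; apply: lime_le; first by apply/cvg_ex; eexists; exact: cv.
apply: nearW => n; have := @trunc_moment_le p n.+1%:R (ltr0Sn _ _).
rewrite -lee_fin; apply: le_trans; rewrite le_eqVlt; apply/orP; left; apply/eqP.
rewrite /trunc_moment -RintegralZl//; last exact: integrable_gaussian_moment.
rewrite /Rintegral fineK; last first.
  apply: integrable_fin_num => //.
  exact: (integrableZl _ _ (integrable_gaussian_moment _ _ _)).
by apply: eq_integral => x _; rewrite /f normal_pdf01E mulrCA.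
Qed.

End NormalMoments.

Section GaussianMoments.
Variable R : realFieldType.

Lemma gmom_odd (v : R) k : odd k -> gmom v k = 0.
Proof.
elim/ltn_ind: k => -[|[|k]] IH // ok.
by rewrite gmomS /= IH ?mulr0//; move: ok => /=; rewrite negbK.
Qed.

Lemma gmom_even (v : R) k : gmom v (2 * k) = v ^+ k * gmom 1 (2 * k).
Proof.
elim: k => [|k IH]; first by rewrite muln0 expr0 mul1r.
have -> : (2 * k.+1 = (2 * k).+2)%N by lia.
by rewrite !gmomS !succnK IH exprS; ring.
Qed.
End GaussianMoments.

Section SubgaussianMoments.
Context (d : measure_display) (T : measurableType d) (R : realType) (P : probability T R).
Variable X : {RV P >-> R}.
Hypothesis X_sym : symmetrically_distributed P X.
Hypothesis X_mom : forall p : nat,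
  ('E_P[fun w => (X w ^+ (2 * p))%R] <=
   'E_(normal_prob 0 1)[fun x : R => (x ^+ (2 * p))%R])%E.
Local Notation E F := (Rintegral P setT F).

Lemma even_moment_le p : (\int[P]_w (X w ^+ (2 * p))%:E <= (gmom 1 (2 * p))%:E)%E.
Proof. by have := le_trans (X_mom p) (normal_moment_le R p); rewrite unlock. Qed.

Let measurable_pow k : measurable_fun setT (fun w => X w ^+ k).
Proof. exact: measurable_funX. Qed.

Lemma integrable_pow k : P.-integrable setT (fun w => (X w ^+ k)%:E).
Proof.
(* The inequality a <= 1 + a^2 with a = |X|^k lets even moments control every power. *)
have int2 : P.-integrable setT (fun w => (1 + X w ^+ (2 * k))%:E).
  apply/integrableP; split.
    by apply/measurable_EFinP; apply: measurable_funD.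
  under eq_integral => w _.
    rewrite gee0_abs ?EFinD; last first.
      by rewrite lee_fin addr_ge0// exprM exprn_ge0// sqr_ge0.
    over.
  rewrite ge0_integralD//=; last first.
  - exact/measurable_EFinP.
  - by move=> w _; rewrite lee_fin exprM exprn_ge0// sqr_ge0.
  rewrite integral_cst//= mul1e probability_setT.
  by apply: lte_add_pinfty; rewrite ?ltry//; apply: le_lt_trans (even_moment_le _) (ltry _).
apply: (le_integrable measurableT _ _ int2); first exact/measurable_EFinP.
move=> w _; rewrite /= lee_fin normrX [leRHS]ger0_norm; last first.
  by rewrite addr_ge0// exprM exprn_ge0// sqr_ge0.
rewrite mulnC exprM -(real_normK (num_real (X w ^+ k))) normrX.
move: (`|X w| ^+ k) (exprn_ge0 k (normr_ge0 (X w))) => a a0.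
by have := sqr_ge0 (a - 1); nra.
Qed.

(** For odd [k] the negative part of [X ^+ k] is the positive part of [(- X) ^+ k], which has the
    same integral by symmetry. *)
Lemma odd_moment k : odd k -> E (fun w => X w ^+ k) = 0.
Proof.
move=> ok.
have mN : measurable_fun setT (\- X) by exact: measurable_funN.
pose f (x : R) : R := Num.max (x ^+ k) 0.
have mf : measurable_fun setT f by apply: measurable_maxr => //; exact: measurable_funX.
have f0 x : 0 <= f x by rewrite /f le_max lexx orbT.
have fN : (\int[P]_w (f (X w))%:E = \int[P]_w (f (- X w))%:E)%E.
  rewrite -(@ge0_integral_distribution _ _ _ _ _ P X (EFin \o f))//=; last first.
  - exact/measurable_EFinP.
  rewrite -(@image_density _ _ _ _ _ P (distribution P X) (\- X) (cst 1))//.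
    by apply: eq_integral => w _; rewrite mulr1.
  move=> A mA; under eq_integral do rewrite mulr1.
  rewrite -[RHS]/(P (X @^-1` A)) X_sym// -[in RHS](setIT (_ @^-1` _)).
  rewrite -integral_indic// -[X in measurable X]setTI; exact: mN.
rewrite /Rintegral integralE.
rewrite (_ : integral _ _ _ = \int[P]_w (f (X w))%:E)%E; last first.
  by apply: eq_integral => w _; rewrite funeposE -EFin_max.
rewrite [X in (_ - X)%E](_ : _ = \int[P]_w (f (- X w))%:E)%E; last first.
  apply: eq_integral => w _; rewrite funenegE -EFinN -EFin_max /f.
  by rewrite exprNn -signr_odd ok expr1 mulN1r.
rewrite -fN subee//; apply: integrable_fin_num => //.
apply: (le_integrable measurableT _ _ (integrable_pow k)).
  by apply/measurable_EFinP; exact: measurableT_comp.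
move=> w _ /=; rewrite lee_fin (ger0_norm (f0 _)) /f.
by rewrite ge_max ler_norm normr_ge0.
Qed.

(** Odd moments vanish, even ones are bounded by assumption. The lower bound 0 allows these
    comparisons to be multiplied over independent entries. *)
Lemma scaled_moment (c : R) k :
  0 <= E (fun w => (c * X w) ^+ k) <= gmom (c ^+ 2) k.
Proof.
have -> : E (fun w => (c * X w) ^+ k) = c ^+ k * E (fun w => X w ^+ k).
  rewrite -RintegralZl//; last exact: integrable_pow.
  by apply: eq_Rintegral => w _; rewrite exprMn.
have [ok|ek] := boolP (odd k); first by rewrite odd_moment// gmom_odd// mulr0 lexx.
have -> : (k = 2 * k./2)%N by rewrite mul2n even_halfK.
rewrite gmom_even exprM; have c0 : 0 <= (c ^+ 2) ^+ k./2 by rewrite exprn_ge0// sqr_ge0.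
apply/andP; split.
  rewrite mulr_ge0//; apply: Rintegral_ge0 => w _.
  by rewrite exprM exprn_ge0// sqr_ge0.
rewrite ler_wpM2l// -lee_fin /Rintegral fineK ?even_moment_le//.
by apply: integrable_fin_num => //; exact: integrable_pow.
Qed.

End SubgaussianMoments.

(** * The spectral norm of a symmetric matrix *)

Lemma char_poly_eval (R : comNzRingType) n (A : 'M[R]_n) c :
  (char_poly A).[c] = \det (c%:M - A).
Proof.
rewrite -horner_evalE -det_map_mx; congr (\det _); apply/matrixP => i j.
by rewrite !mxE /= rmorphB /= !horner_evalE hornerMn hornerX hornerC.
Qed.

Section SpectralNorm.
Variables (R : realType) (n : nat).
Implicit Types A B : 'M[R]_n.

Lemma cauchy_schwarz_sum (a c : 'I_n -> R) :
  (\sum_i a i * c i) ^+ 2 <= (\sum_i a i ^+ 2) * (\sum_i c i ^+ 2).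
Proof.
rewrite -subr_ge0.
(* Lagrange's identity. *)
have : 0 <= \sum_i \sum_j (a i * c j - a j * c i) ^+ 2.
  by apply: sumr_ge0 => i _; apply: sumr_ge0 => j _; apply: sqr_ge0.
have sepE (f g : 'I_n -> R) : \sum_i \sum_j f i * g j = (\sum_i f i) * (\sum_i g i).
  by rewrite mulr_suml; apply: eq_bigr => i _; rewrite mulr_sumr.
have -> : \sum_i \sum_j (a i * c j - a j * c i) ^+ 2 =
    \sum_i \sum_j a i ^+ 2 * c j ^+ 2 + \sum_i \sum_j c i ^+ 2 * a j ^+ 2
    - 2 * (\sum_i \sum_j (a i * c i) * (a j * c j)).
  rewrite mulr_sumr -sumrN -!big_split; apply: eq_bigr => i _ /=.
  rewrite mulr_sumr -sumrN -!big_split; apply: eq_bigr => j _ /=.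
  by ring.
by rewrite !sepE expr2; nra.
Qed.

Lemma mxtrace_mul_tr B : \tr (B *m B^T) = \sum_i \sum_j B i j ^+ 2.
Proof.
by rewrite /mxtrace; apply: eq_bigr => i _; rewrite mxE; apply: eq_bigr => j _; rewrite mxE.
Qed.

Lemma sqr_row_mulmx_le (v : 'rV[R]_n) B :
  \sum_j (v *m B) 0 j ^+ 2 <= (\sum_i v 0 i ^+ 2) * \tr (B *m B^T).
Proof.
rewrite mxtrace_mul_tr exchange_big/= mulr_sumr; apply: ler_sum => j _.
by rewrite mxE; apply: cauchy_schwarz_sum.
Qed.

Lemma tr_expmx A k : (A ^+ k)^T = A^T ^+ k.
Proof.
elim: k => [|k IH]; first by rewrite !expr0 trmx1.
by rewrite exprS exprSr trmx_mul IH.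
Qed.

(** An eigenvector [v] of [A ^+ 2] satisfies |v A^p|^2 = s^(2p) |v|^2, and the Frobenius norm of
    [A ^+ p] bounds the left side; no diagonalization is involved. *)
Lemma singular_value_trace A s p : A^T = A -> singular_value A s ->
  s ^+ (2 * p) <= \tr (A ^+ (2 * p)).
Proof.
move=> symA [s0 /eigenvalueP [v]]; rewrite symA => vA v0.
have vAp q : v *m A ^+ (2 * q) = s ^+ (2 * q) *: v.
  elim: q => [|q IH]; first by rewrite muln0 !expr0 mulmx1 scale1r.
  rewrite mulnS addnC [A ^+ _]exprD -[_ * _]/(A ^+ (2 * q) *m A ^+ 2) mulmxA IH.
  by rewrite -scalemxAl [A ^+ 2]expr2 [v *m _]vA scalerA -exprD.
have v_gt0 : 0 < \sum_i v 0 i ^+ 2.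
  rewrite lt_neqAle sumr_ge0 ?andbT => [|i _]; last exact: sqr_ge0.
  apply: contraNneq v0 => /esym/eqP; rewrite psumr_eq0 => [/allP v_eq0|i _]; last exact: sqr_ge0.
  apply/eqP/rowP => i; rewrite mxE; apply/eqP; rewrite -sqrf_eq0.
  by apply: v_eq0; rewrite mem_index_enum.
have trE : A ^+ (2 * p) = A ^+ p *m (A ^+ p)^T by rewrite tr_expmx symA mul2n -addnn exprD.
have := sqr_row_mulmx_le v (A ^+ p).
have -> : \sum_j (v *m A ^+ p) 0 j ^+ 2 = s ^+ (2 * p) * \sum_i v 0 i ^+ 2.
  transitivity ((v *m A ^+ p *m (v *m A ^+ p)^T) 0 0).
    by rewrite mxE; apply: eq_bigr => j _; rewrite [_^T _ _]mxE.
  rewrite trmx_mul mulmxA -[X in X *m _]mulmxA -trE vAp -scalemxAl mxE; congr (_ * _).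
  by rewrite mxE; apply: eq_bigr => j _; rewrite [_^T _ _]mxE.
by rewrite -trE mulrC ler_pM2l.
Qed.

Lemma singular_value_le A s : A^T = A -> singular_value A s -> s <= 1 + \tr (A ^+ 2).
Proof.
move=> symA sA; have := singular_value_trace 1 symA sA.
rewrite muln1; case: sA => s0 _; nra.
Qed.

Lemma singular_valueE A s : 0 <= s ->
  singular_value A s <-> (char_poly (A^T *m A)).[s ^+ 2] = 0.
Proof.
move=> s0; rewrite /singular_value /= eigenvalue_root_char.
by split => [[_ /rootP]//|/rootP ?]; split.
Qed.

Lemma spectral_norm_gt A th : A^T = A -> 0 <= th ->
  th < spectral_norm A <-> exists2 s, th < s & singular_value A s.
Proof.
move=> symA th0; split=> [|[s ths sA]]; last first.
  apply: lt_le_trans ths _; apply: ub_le_sup => //.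
  by exists (1 + \tr (A ^+ 2)) => u; apply: singular_value_le.
have [[s0 _] /(sup_gt s0) [s sA ths]|nhs] := pselect (has_sup (singular_value A)).
  by exists s.
(* Where no supremum exists, [sup] takes the value 0, which does not exceed [th]. *)
by rewrite /spectral_norm sup_out// => /(le_lt_trans th0); rewrite ltxx.
Qed.

Lemma spectral_norm_trace A th p : A^T = A -> 0 <= th -> th < spectral_norm A ->
  th ^+ (2 * p) <= \tr (A ^+ (2 * p)).
Proof.
move=> symA th0 /(spectral_norm_gt symA th0) [s ths sA].
apply: le_trans (singular_value_trace p symA sA).
by rewrite lerXn2r ?nnegrE// ltW// (le_lt_trans th0).
Qed.

Lemma spectral_norm0_le0 : spectral_norm (0 : 'M[R]_n) <= 0.
Proof.
rewrite leNgt; apply/negP => /(spectral_norm_gt (trmx0 _ _ _) (lexx 0)).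
case=> s s_gt0 /(singular_value_trace 1 (trmx0 _ _ _)).
by rewrite muln1 (expr2 (0 : 'M[R]_n)) -[_ * _]/(0 *m 0) mul0mx mxtrace0; nra.
Qed.

End SpectralNorm.

(* By compactness of [a, m], the continuous function [f w] has a zero in [a, m]
   if and only if it takes arbitrarily small values at rational points. *)
Lemma measurable_exists_root (d : measure_display) (T : measurableType d) (R : realType)
    (f : T -> R -> R) (th : R) :
  (forall x, measurable_fun setT (fun w => f w x)) -> (forall w, continuous (f w)) ->
  measurable [set w | exists2 x, th < x & f w x = 0].
Proof.
move=> mf cf.
(* These compact intervals exhaust the half-line beyond [th]; each stays away from [th], so the
   strict inequality survives the limit. *)
pose lo m := th + m.+1%:R^-1 : R; pose hi m := m%:R : R.
have -> : [set w | exists2 x, th < x & f w x = 0] =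
    \bigcup_m \bigcap_k \bigcup_(q : rat)
      (if lo m <= ratr q <= hi m then [set w | `|f w (ratr q)| < k.+1%:R^-1] else set0).
  apply/seteqP; split => [w [x thx fx]|w [m _ smallf]].
    have [m [lox xhi]] : exists m, lo m < x /\ x < hi m.
      have [m1 m1P] : exists m, (x - th)^-1 < m%:R.
        by exists (Num.truncn (x - th)^-1).+1; exact: truncnS_gt.
      have [m2 m2P] : exists m, x < m%:R by exists (Num.truncn x).+1; exact: truncnS_gt.
      exists (maxn m1 m2); split; last first.
        by apply: lt_le_trans m2P _; rewrite ler_nat leq_maxr.
      rewrite /lo addrC -ltrBrDr invf_plt ?posrE ?subr_gt0//.
      by apply: lt_trans m1P _; rewrite ltr_nat ltnS leq_maxl.
    exists m => // k _.
    have k0 : 0 < k.+1%:R^-1 :> R by rewrite invr_gt0.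
    have /cvgrPdist_lt/(_ _ k0)/nbhs_ballP [e /= e0 eP] := cf w x.
    have /rat_in_itvoo [q] : Num.max (lo m) (x - e) < Num.min (hi m) (x + e).
      by rewrite lt_min !gt_max; apply/and3P; split; first (apply/andP; split); lra.
    rewrite in_itv/= gt_max lt_min => /andP[/andP[q1 q2] /andP[q3 q4]].
    exists q => //; rewrite !ltW//=.
    have := eP (ratr q); rewrite fx sub0r normrN; apply.
    by rewrite /ball/= ltr_norml; apply/andP; split; lra.
  have lohi : lo m <= hi m.
    by have [q _] := smallf 0%N I; case: ifP => // /andP[h1 h2] _; exact: le_trans h1 h2.
  have [|c cI cmin] := @EVT_min R (fun x => `|f w x|) (lo m) (hi m) lohi.
    by apply: continuous_subspaceT => x; apply: continuous_comp; [exact: cf|exact: norm_continuous].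
  exists c.
    by move: cI; rewrite in_itv /lo /= => /andP[+ _]; apply: lt_le_trans; rewrite ltrDl invr_gt0.
  apply/eqP/negPn; rewrite -normr_gt0; apply/negP => fc0.
  have [q _] := smallf (Num.truncn (`|f w c|^-1)) I; case: ifP => // qI /= fq.
  have := le_lt_trans (cmin (ratr q) _) fq; rewrite in_itv/= qI => /(_ isT).
  by rewrite -[X in X < _]invrK ltf_pV2 ?posrE ?invr_gt0// ltNge (ltW (truncnS_gt _)).
apply: bigcupT_measurable => m; apply: bigcapT_measurable => k.
apply: bigcupT_measurable_rat => q; case: ifP => // _.
rewrite -[X in measurable X]setTI.
have mnf : measurable_fun setT (fun w => `|f w (ratr q)|).
  by apply: measurableT_comp => //; exact: measurable_normr.
have mk : measurable_fun [set: T] (fun=> k.+1%:R^-1 : R) by exact: measurable_cst.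
have := measurable_fun_ltr mnf mk measurableT (Y := [set true]) I.
by congr measurable; congr (_ `&` _); apply/seteqP; split => w /= ->.
Qed.

Lemma random_mx_tr (T : Type) (R : realType) n (b : 'M[R]_n) (xi : 'I_n -> 'I_n -> T -> R) w :
  (forall i j, b i j = b j i) -> (forall i j, xi i j w = xi j i w) ->
  (random_mx b xi w)^T = random_mx b xi w.
Proof.
move=> b_sym xi_sym; apply/matrixP => i j; rewrite !mxE eq_sym.
by case: eqP => [->//|_]; rewrite b_sym xi_sym.
Qed.

(** The event says that the characteristic polynomial of the Gram matrix vanishes at the square of
    some [s] beyond [th]; its values are determinants, hence measurable in the entries. *)
Lemma measurable_spectral_norm_gt (d : measure_display) (T : measurableType d) (R : realType)
    n (M : T -> 'M[R]_n) (th : R) :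
  (forall i j, measurable_fun setT (fun w => M w i j)) -> (forall w, (M w)^T = M w) ->
  0 <= th -> measurable [set w | th < spectral_norm (M w)].
Proof.
move=> mM symM th0.
have -> : [set w | th < spectral_norm (M w)] =
    [set w | exists2 s, th < s & (char_poly ((M w)^T *m M w)).[s ^+ 2] = 0].
  apply/seteqP; split => w /=.
    move/(spectral_norm_gt (symM w) th0) => [s ths sM].
    by exists s => //; apply/singular_valueE => //; case: sM.
  move=> [s ths sM]; apply/(spectral_norm_gt (symM w) th0); exists s => //.
  by apply/singular_valueE => //; apply: le_trans (ltW ths).
apply: measurable_exists_root => [s|w s]; last first.
  apply: (@continuous_comp _ _ _ (fun x : R => x ^+ 2) (horner _)); first exact: exprn_continuous.
  exact: continuous_horner.
under eq_fun do rewrite char_poly_eval.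
apply: measurable_sum => g; apply: measurable_funM => //.
apply: measurable_prod => i _.
under eq_fun do rewrite !mxE.
apply: measurable_funB => //; apply: measurable_sum => k; apply: measurable_funM => //.
by under eq_fun => w do rewrite symM; exact: mM.
Qed.

(** * The tail bound *)

Lemma markov_Rintegral (d : measure_display) (T : measurableType d) (R : realType)
    (P : probability T R) (A : set T) (c : R) (F : T -> R) :
  measurable A -> P.-integrable setT (EFin \o F) -> (forall w, 0 <= F w) ->
  (forall w, A w -> c <= F w) -> c * fine (P A) <= Rintegral P setT F.
Proof.
move=> mA intF F0 cF.
rewrite -Rintegral_cst// Rintegral_mkcond; apply: le_Rintegral => // [|w _].
  have : P.-integrable A (EFin \o cst c).
    by apply: finite_measure_integrable_cst.
  by move/(integrable_mkcond (EFin \o cst c) mA).1; rewrite restrict_EFin.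
rewrite patchE; case: ifPn => [|_ //]; rewrite inE; exact: cF.
Qed.

Lemma mxtrace_even_ge0 (R : realType) n (A : 'M[R]_n) p : A^T = A -> 0 <= \tr (A ^+ (2 * p)).
Proof.
move=> symA; have -> : A ^+ (2 * p) = A ^+ p *m (A ^+ p)^T.
  by rewrite tr_expmx symA mul2n -addnn exprD.
by rewrite mxtrace_mul_tr; apply: sumr_ge0 => i _; apply: sumr_ge0 => j _; apply: sqr_ge0.
Qed.

Section CoshCoefficients.
Variable R : realFieldType.

(* Odd powers are left out since only the even ones bound the trace below by a
   power of a singular value. *)
Definition cosh_coeff (x : R) k : R := if odd k then 0 else x ^+ k / k`!%:R.

Lemma cosh_coeff_ge0 x k : 0 <= x -> 0 <= cosh_coeff x k.
Proof. by move=> x0; rewrite /cosh_coeff; case: ifP => // _; rewrite divr_ge0 ?exprn_ge0. Qed.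

Lemma cosh_coeffM x y k : cosh_coeff x k * y ^+ k = cosh_coeff (x * y) k.
Proof. by rewrite /cosh_coeff; case: ifP; rewrite ?mul0r// exprMn mulrAC. Qed.

Lemma sum_cosh_coeff y N :
  2 * \sum_(k < N) cosh_coeff y k = egf y (fun=> 1) N + egf (- y) (fun=> 1) N.
Proof.
rewrite /egf -big_split mulr_sumr; apply: eq_bigr => k _ /=.
by rewrite /cosh_coeff exprNn -signr_odd; case: (odd k) => /=; ring.
Qed.

End CoshCoefficients.

(** From exp y <= 2 cosh y, the origin of the factor 2 in the tail bound; the truncation tends to
    infinity with [q] and [C] fixed. *)
Lemma expR_le_of_cosh (R : realType) (y q C : R) : 0 <= q ->
  (forall N, (egf y (fun=> 1) N + egf (- y) (fun=> 1) N) * q <= C) -> expR y * q <= C.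
Proof.
move=> q0 H; apply: (@le_trans _ _ ((expR y + expR (- y)) * q)).
  by rewrite ler_wpM2r// lerDl expR_ge0.
apply: (@cvgr_to_le _ \oo _ _ (fun N => (egf y (fun=> 1) N + egf (- y) (fun=> 1) N) * q)).
  apply: cvgMl; rewrite /expR.
  have cvgE z : (fun N => egf z (fun=> 1) N) @ \oo --> limn (series (exp_coeff z)).
    by under eq_fun do rewrite egf1E; exact: is_cvg_series_exp_coeff.
  by apply: cvgD; exact: cvgE.
exact: nearW.
Qed.

Lemma mxtrace_walks (R : realType) (n : nat) (A : 'M[R]_n) k :
  \tr (A ^+ k) = \sum_i wsum (walk 0 k i i) (fun w => \prod_(e <- w) A e.1 e.2).
Proof.
suff H i j : (A ^+ k) i j = wsum (walk 0 k i j) (fun w => \prod_(e <- w) A e.1 e.2).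
  by rewrite /mxtrace; apply: eq_bigr => i _.
elim: k i => [|k IH] i; first by rewrite walks0 big_nil mulr1 expr0 mxE.
rewrite walksS mul0r add0r exprS mxE; apply: eq_bigr => x _.
by rewrite IH -wsumZ; apply: eq_wsum => w; rewrite big_cons.
Qed.

Section RandomMatrix.
Context (d : measure_display) (T : measurableType d) (R : realType) (P : probability T R).
Variables (n : nat) (b : 'M[R]_n) (xi : 'I_n -> 'I_n -> {RV P >-> R}).
Hypothesis b_sym : forall i j, b i j = b j i.
Hypothesis xi_sym : forall i j w, xi i j w = xi j i w.
Hypothesis xi_symdist : forall i j, symmetrically_distributed P (xi i j).
Hypothesis xi_indep : independent_RVs P
  [set ij : 'I_n * 'I_n | (ij.2 <= ij.1)%N]%SET (fun ij => xi ij.1 ij.2).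
Hypothesis xi_moments : forall i j (p : nat),
  ('E_P[fun w => (xi i j w ^+ (2 * p))%R]
   <= 'E_(normal_prob 0 1)[fun x : R => (x ^+ (2 * p))%R])%E.
Local Notation E F := (Rintegral P setT F).
Local Notation edge := ('I_n * 'I_n)%type.
Local Notation M w := (random_mx b xi w).

Definition entry_scale (p : edge) : R :=
  if p.1 == p.2 then Num.sqrt 2 * b p.1 p.1 else b p.1 p.2.

Lemma entry_scale_sqr p : entry_scale p ^+ 2 = entry_var b p.
Proof.
rewrite /entry_scale /entry_var; case: ifP => // _.
by rewrite exprMn sqr_sqrtr.
Qed.

Lemma random_mx_entry (e : edge) w : M w e.1 e.2 =
  entry_scale (ecanon e) * xi (ecanon e).1 (ecanon e).2 w.
Proof.
case: e => i j; rewrite mxE /ecanon /entry_scale /eswap /=.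
have [->|ij] := eqVneq i j; first by rewrite leqnn /= eqxx.
have ji : j != i by rewrite eq_sym.
by case: (leqP j i) => _ /=; rewrite ?(negbTE ij) ?(negbTE ji)// b_sym xi_sym.
Qed.

Lemma prod_random_mx (s : seq edge) w : \prod_(e <- s) M w e.1 e.2 =
  \prod_(p : edge | (p.2 <= p.1)%N)
    (entry_scale p * xi p.1 p.2 w) ^+ count (fun e => ecanon e == p) s.
Proof.
elim: s => [|e s IH]; first by rewrite big_nil big1.
rewrite big_cons IH random_mx_entry /=.
under [RHS]eq_bigr do rewrite exprD.
rewrite big_split/=; congr (_ * _).
rewrite (bigD1 (ecanon e)) ?ecanon_le//= eqxx expr1 big1 ?mulr1// => p /andP[_ /negbTE pe].
by rewrite eq_sym pe expr0.
Qed.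

Let D := [set ij : edge | (ij.2 <= ij.1)%N]%SET.
Let f (s : seq edge) (p : edge) (x : R) :=
  (entry_scale p * x) ^+ count (fun e => ecanon e == p) s.

Let prodE s w : \prod_(e <- s) M w e.1 e.2 = \prod_(p <- enum D) f s p (xi p.1 p.2 w).
Proof.
by rewrite prod_random_mx big_enum/=; apply: eq_bigl => p; rewrite inE.
Qed.

Let mf s p : measurable_fun setT (f s p).
Proof. by apply: measurable_funX; apply: measurable_funM. Qed.

Let intf s p : P.-integrable setT (fun w => (f s p (xi p.1 p.2 w))%:E).
Proof.
have := integrableZl measurableT (entry_scale p ^+ count (fun e => ecanon e == p) s)
  (integrable_pow (xi_moments p.1 p.2) (count (fun e => ecanon e == p) s)).
by apply: eq_integrable => // w _; rewrite /f exprMn EFinM.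
Qed.

Lemma integrable_word (s : seq edge) :
  P.-integrable setT (fun w => (\prod_(e <- s) M w e.1 e.2)%:E).
Proof.
have sD : {subset enum D <= D} by move=> p; rewrite mem_enum.
have := @indep_prod_integrable _ _ _ P _ D _ xi_indep (f s) (enum D) (intf s) (mf s)
  (enum_uniq _) sD.
by apply: eq_integrable => // w _; rewrite prodE.
Qed.

Lemma word_moment_le (s : seq edge) : E (fun w => \prod_(e <- s) M w e.1 e.2) <= gword b s.
Proof.
under eq_Rintegral do rewrite prodE.
rewrite (@indep_prod _ _ _ P _ D _ xi_indep (f s) (enum D) (intf s) (mf s) (enum_uniq _)).
  rewrite big_enum/= /gword [leRHS](eq_bigl (fun p => p \in D)) => [|p]; last by rewrite inE.
  by apply: ler_prod => p _; rewrite -entry_scale_sqr; apply: scaled_moment.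
by move=> p; rewrite mem_enum.
Qed.

Let integrable_linear (a c : R) (F G : T -> R) :
  P.-integrable setT (EFin \o F) -> P.-integrable setT (EFin \o G) ->
  P.-integrable setT (EFin \o (fun w => a * F w + c * G w)) /\
  E (fun w => a * F w + c * G w) = a * E F + c * E G.
Proof.
move=> intF intG.
have intaF : P.-integrable setT (EFin \o (fun w => a * F w)).
  exact: (integrableZl measurableT a intF).
have intcG : P.-integrable setT (EFin \o (fun w => c * G w)).
  exact: (integrableZl measurableT c intG).
split; last by rewrite RintegralD// !RintegralZl.
exact: (integrableD measurableT intaF intcG).
Qed.

Lemma integrable_lincomb (I : Type) (r : seq I) (a : I -> R) (F : I -> T -> R) :
  (forall i, P.-integrable setT (EFin \o F i)) ->
  P.-integrable setT (EFin \o (fun w => \sum_(i <- r) a i * F i w)) /\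
  E (fun w => \sum_(i <- r) a i * F i w) = \sum_(i <- r) a i * E (F i).
Proof.
move=> intF; elim: r => [|i r [IH1 IH2]].
  have e0 : (fun w : T => \sum_(i <- [::]) a i * F i w) = cst 0.
    by apply/funext => w; rewrite big_nil.
  rewrite e0 big_nil Rintegral_cst// mul0r; split => //.
  exact: integrable0.
have [int1 int2] := integrable_linear (a i) 1 (intF i) IH1.
have eS : (fun w : T => \sum_(j <- i :: r) a j * F j w) =
    (fun w => a i * F i w + 1 * \sum_(j <- r) a j * F j w).
  by apply/funext => w; rewrite big_cons mul1r.
by rewrite eS int2 IH2 mul1r big_cons.
Qed.

Lemma trace_moment k : P.-integrable setT (EFin \o (fun w => \tr (M w ^+ k))) /\
  E (fun w => \tr (M w ^+ k)) <= \sum_i wsum (walk 0 k i i) (gword b).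
Proof.
pose F (p : R * seq edge) w := \prod_(e <- p.2) M w e.1 e.2.
have intF p : P.-integrable setT (EFin \o F p) by exact: integrable_word.
pose G i w := \sum_(p <- walk 0 k i i) p.1 * F p w.
have intG i := integrable_lincomb (walk 0 k i i) (fun p => p.1) intF.
have [int1 int2] := integrable_lincomb (index_enum 'I_n) (fun=> 1) (fun i => (intG i).1).
have trE : (fun w => \tr (M w ^+ k)) = (fun w => \sum_i 1 * G i w).
  by apply/funext => w; rewrite mxtrace_walks; apply: eq_bigr => i _; rewrite mul1r.
rewrite trE; split => //; rewrite int2; apply: ler_sum => i _.
rewrite mul1r (intG i).2 /wsum.
have := @walk_ge0 R n 0 k i i (lexx 0); elim: (walk 0 k i i) => [|p s IH] /=.
  by rewrite !big_nil.
case/andP => p0 /IH{}IH; rewrite !big_cons lerD// ler_wpM2l//.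
exact: word_moment_le.
Qed.

Lemma measurable_spectral_norm_event th : 0 <= th ->
  measurable [set w | th < spectral_norm (M w)].
Proof.
move=> th0; apply: measurable_spectral_norm_gt => // [i j|w]; last exact: random_mx_tr.
have -> : (fun w => M w i j) = (fun w => entry_scale (ecanon (i, j)) *
    xi (ecanon (i, j)).1 (ecanon (i, j)).2 w).
  by apply/funext => w; rewrite -random_mx_entry.
by apply: measurable_funM => //; exact: measurable_funP.
Qed.

Lemma spectral_norm_tail (r : nat) (sg s th : R) : (0 < r)%N -> 0 <= sg -> 0 <= s -> 0 <= th ->
  (forall i j, b i j ^+ 2 <= sg ^+ 2) -> (forall i, \sum_j b i j ^+ 2 <= r%:R * sg ^+ 2) ->
  fine (P [set w | th < spectral_norm (M w)]) <=
  2 * n%:R * expR (2 * Num.sqrt r.-1%:R * (s * sg) + (s * sg) ^+ 2 - s * th).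
Proof.
move=> r0 sg0 s0 th0 b_le row_le.
have mE := measurable_spectral_norm_event th0.
set A := [set w | _]; set e := 2 * _ * _ + _.
have symM w : (M w)^T = M w by exact: random_mx_tr.
rewrite expRD expRN mulrA ler_pdivlMr ?expR_gt0// mulrC.
apply: expR_le_of_cosh => [|N]; first exact: fine_ge0.
rewrite -sum_cosh_coeff -!mulrA ler_pM2l//.
pose F k w := \tr (M w ^+ k).
have momF k := trace_moment k.
have [intW EW] := integrable_lincomb (index_enum 'I_N) (fun k : 'I_N => cosh_coeff s k)
  (fun k : 'I_N => (momF k).1).
apply: le_trans (markov_Rintegral mE intW _ _) _ => [w|w Aw|].
- apply: sumr_ge0 => k _; case ok : (odd k); first by rewrite /cosh_coeff ok mul0r.
  apply: mulr_ge0; first exact: cosh_coeff_ge0.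
  by rewrite (_ : nat_of_ord k = (2 * k./2)%N) ?mxtrace_even_ge0//; lia.
- apply: ler_sum => k _; rewrite -cosh_coeffM.
  case ok : (odd k); first by rewrite /cosh_coeff ok !mul0r.
  apply: ler_wpM2l; first exact: cosh_coeff_ge0.
  by rewrite (_ : nat_of_ord k = (2 * k./2)%N) ?spectral_norm_trace//; lia.
rewrite EW; have r_gt0 : 0 < r%:R :> R by rewrite ltr0n.
(* The factor [r] on the left of [walk_comparison] cancels the one in the GOE bound, which leaves
   the prefactor [n]. *)
rewrite -(ler_pM2l r_gt0) mulr_sumr.
apply: (@le_trans _ _ (n%:R * egf (s * sg) (fun k => goe_trace r 0 [:: k]) N)); last first.
  rewrite mulrCA ler_wpM2l//; apply: goe_mgf => //; exact: mulr_ge0.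
rewrite /egf mulr_sumr; apply: ler_sum => k _.
case ok : (odd k).
  rewrite /cosh_coeff ok mul0r mulr0; apply: mulr_ge0 => //.
  by apply: mulr_ge0; [rewrite divr_ge0// exprn_ge0// mulr_ge0|exact: goe_trace1_ge0].
rewrite /cosh_coeff ok exprMn.
apply: (@le_trans _ _ (s ^+ k / k`!%:R * (n%:R * sg ^+ k * goe_trace r 0 [:: nat_of_ord k]))).
  rewrite mulrCA; apply: ler_wpM2l; first by rewrite divr_ge0// exprn_ge0.
  apply: le_trans (walk_comparison k sg0 b_sym b_le row_le).
  by apply: ler_wpM2l => //; exact: (momF k).2.
by rewrite le_eqVlt; apply/orP; left; apply/eqP; ring.
Qed.

End RandomMatrix.

Section Variances.
Variables (R : realType) (n : nat) (b : 'M[R]_n).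

Lemma sqr_le_sigma_star i j : b i j ^+ 2 <= sigma_star b ^+ 2.
Proof.
rewrite /sigma_star sqr_sqrtr; last exact: bigmax_ge_id.
apply: le_trans (le_bigmax 0 (fun i => \big[Num.max/0]_j b i j ^+ 2) i).
exact: (le_bigmax 0 (fun j => b i j ^+ 2) j).
Qed.

Lemma row_le_sigma i : \sum_j b i j ^+ 2 <= sigma b ^+ 2.
Proof.
rewrite /sigma sqr_sqrtr; last exact: bigmax_ge_id.
exact: (le_bigmax 0 (fun i => \sum_j b i j ^+ 2) i).
Qed.

End Variances.

Theorem theorem3p5 (R : realType) (d : measure_display) (T : measurableType d)
    (P : probability T R) (n : nat) (b : 'M[R]_n)
    (xi : 'I_n -> 'I_n -> {RV P >-> R})
    (b_ge0 : forall i j, 0 <= b i j)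
    (b_sym : forall i j, b i j = b j i)
    (xi_sym : forall i j w, xi i j w = xi j i w)
    (xi_symdist : forall i j, symmetrically_distributed P (xi i j))
    (xi_indep : independent_RVs P
       [set ij : 'I_n * 'I_n | (ij.2 <= ij.1)%N]%SET
       (fun ij => xi ij.1 ij.2))
    (xi_moments : forall i j (p : nat),
       ('E_P[fun w => (xi i j w ^+ (2 * p))%R]
        <= 'E_(normal_prob 0 1)[fun x : R => (x ^+ (2 * p))%R])%E)
    (t : R) (t_ge0 : 0 <= t) :
  (P [set w | (2 * sigma b + sigma_star b * (1 + t)
               < spectral_norm (random_mx b xi w))%R]
   <= (2 * n%:R * expR (- (t ^+ 2) / 4))%:E)%E.
Proof.
have s0 : 0 <= sigma b by exact: sqrtr_ge0.
have ss0 : 0 <= sigma_star b by exact: sqrtr_ge0.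
(* The choice of [s] divides by [sigma_star b]; when this is 0 the matrix vanishes and the event is
   empty. *)
have [ss_eq|ss_neq] := eqVneq (sigma_star b) 0.
  have -> : [set w | (2 * sigma b + sigma_star b * (1 + t)
               < spectral_norm (random_mx b xi w))%R] = set0.
    apply/seteqP; split => // w /=; rewrite ss_eq mul0r addr0.
    have th0 : 0 <= 2 * sigma b by lra.
    have b0 i j : b i j = 0.
      apply/eqP; rewrite -sqrf_eq0 eq_le sqr_ge0 andbT.
      by rewrite (le_trans (sqr_le_sigma_star b i j))// ss_eq expr0n.
    have -> : random_mx b xi w = 0.
      by apply/matrixP => i j; rewrite !mxE !b0; case: ifP => _; ring.
    by move/(le_lt_trans th0); rewrite ltNge spectral_norm0_le0.
  by rewrite measure0 lee_fin !mulr_ge0 ?expR_ge0.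
have ss_gt0 : 0 < sigma_star b by rewrite lt_neqAle eq_sym ss_neq.
set q := sigma b / sigma_star b.
have q0 : 0 <= q by exact: divr_ge0.
(* The upper bound on [q ^+ 2] gives the row sums required in dimension [r]; the lower one bounds
   the square root of [r - 1] by [q]. *)
have /andP[q_ge q_lt] := truncn_itv (sqr_ge0 q).
set th := 2 * sigma b + _.
have th0 : 0 <= th by rewrite /th; nra.
have sE : sigma b = q * sigma_star b by rewrite /q divfK.
have := @spectral_norm_tail _ _ _ _ _ _ _ b_sym xi_sym xi_symdist xi_indep xi_moments
  (Num.truncn (q ^+ 2)).+1 (sigma_star b) (t / (2 * sigma_star b)) th isT ss0 _ th0
  (sqr_le_sigma_star b) _.
rewrite -[P _]fineK ?fin_num_measure//; last exact: measurable_spectral_norm_event.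
move=> tail; rewrite lee_fin; apply: le_trans (tail _ _) _.
- by rewrite divr_ge0// mulr_ge0.
- move=> i; apply: le_trans (row_le_sigma b i) _.
  by rewrite sE exprMn ler_wpM2r ?sqr_ge0// ltW.
apply: ler_wpM2l; first by rewrite mulr_ge0.
(* With [x = s * sigma_star b], the value [x = t / 2] minimizes [x ^+ 2 - t * x], and the minimum is
   [- (t ^+ 2) / 4]. *)
rewrite ler_expR /=.
have -> : t / (2 * sigma_star b) * sigma_star b = t / 2 by field.
have -> : t / (2 * sigma_star b) * th = t * q + t * (1 + t) / 2 by rewrite /th sE; field.
have : Num.sqrt (Num.truncn (q ^+ 2))%:R <= q.
  by apply: le_trans (ler_wsqrtr q_ge) _; rewrite sqrtr_sqr ger0_norm.
nra.
Qed.
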